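(* Let $n\ge 2$, let $G_1,\dots,G_n$ be non-trivial finitely generated groups with finite generating sets $S_1,\dots,S_n$, and let $\mathcal{G}$ be the Cayley graph of the free product $G_1*\cdots*G_n$ with respect to $\bigcup_{i=1}^n S_i$. Let $p_c$ be the critical probability of Bernoulli bond percolation on $\mathcal{G}$, and let $\chi_i(p)=\mathrm{E}_p(|C|_{G_i})$ be the expected size of the cluster of the origin in the Cayley graph of $G_i$ with respect to $S_i$. Then the expected size of the cluster at the origin in $\mathcal{G}$ equals $$\mathrm{E}_p(|C|_{G_1*\cdots*G_n})=\frac{\prod_{i=1}^n\chi_i(p)}{\sum_{j=1}^n\prod_{i=1,i\neq j}^n\chi_i(p)-(n-1)\prod_{i=1}^n\chi_i(p)}$$ for $0\le p<p_c$, and it is infinite for $p_c\le p\le 1$.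
   Context: Cayley graph: for a group $G$ with finite generating set $S$, the graph has vertex set $G$, and $g,h$ are adjacent iff $g^{-1}h\in S$ or $h^{-1}g\in S$, with the appropriate multiplicity (one edge joining $g$ and $gs$ for each pair $(g,s)\in G\times S$). The origin $o$ is the identity element. Bernoulli bond percolation with parameter $p\in[0,1]$ on a graph: each edge is independently open with probability $p$ and closed otherwise; $\mathrm{P}_p$ is the resulting product probability measure and $\mathrm{E}_p$ its expectation. A cluster is a connected component of the random subgraph (on all vertices) of open edges; $C$ is the cluster containing $o$, and $|C|$ is its number of vertices (written $|C|_G$ when the graph is the Cayley graph of $G$). The percolation function is $\theta(p)=\mathrm{P}_p(|C|=\infty)$ and the critical probability is $p_c=\inf\{p\in[0,1]:\theta(p)>0\}$. *)

(* Defs.v *)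
From HB Require Import structures.
From mathcomp Require Import all_boot all_order all_algebra.
From mathcomp Require Import finmap all_classical all_reals all_analysis.
From mathcomp Require Import measurable_realfun.
From mathcomp Require Import ring lra.
Set Implicit Arguments.
Unset Strict Implicit.
Unset Printing Implicit Defensive.
Import Order.TTheory GRing.Theory Num.Theory.
Import numFieldNormedType.Exports.

Section FreeProduct.
Local Open Scope group_scope.
Variables (I : choiceType) (G : I -> groupType).

(* The free product is the set of reduced words: sequences of non-trivial
   letters, consecutive ones lying in different factors. *)
Local Notation fp_letter := {i : I & G i}.

Implicit Types (i : I) (x : fp_letter) (w : seq fp_letter).

Definition reduced w :=
  all (fun x => tagged x != 1) w && sorted (fun x y => tag x != tag y) w.

(* Every reduced word w factors uniquely as h w' with h in G i and w' not
   starting in G i: fp_head and fp_tail are h and w', fp_cons reassembles them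
   and fp_push g is left multiplication by the letter g. *)
Definition fp_head i w : G i :=
  if w is x :: _ then
    if tag x == i then tagged_as (Tagged G (1 : G i)) x else 1
  else 1.

Definition fp_tail i w :=
  if w is x :: w' then if tag x == i then w' else w else [::].

Definition fp_cons i (g : G i) w := if g == 1 then w else Tagged G g :: w.

Definition fp_push i (g : G i) w := fp_cons (g * fp_head i w) (fp_tail i w).

Definition fp_mulw w1 w2 := foldr (fun x w => fp_push (tagged x) w) w2 w1.

Definition fp_invw w := rev [seq Tagged G (tagged x)^-1 | x <- w].

Let no_head i w := if w is x :: _ then tag x != i else true.

Lemma fp_no_head_tail i w : reduced w -> no_head i (fp_tail i w).
Proof.
case: w => [//|x w] /andP[_ /= pw]; case: eqP => [<-|/eqP//].
by case: w pw => [//|y w] /= /andP[+ _]; rewrite eq_sym.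
Qed.

Lemma reduced_tail i w : reduced w -> reduced (fp_tail i w).
Proof.
case: w => [//|x w] /=; case: eqP => // _ /andP[/= /andP[_ aw] pw].
by rewrite /reduced aw (path_sorted pw).
Qed.

Lemma fp_head_cons i (g : G i) w : no_head i w -> fp_head i (fp_cons g w) = g.
Proof.
rewrite /fp_cons; case: eqP => [->|_ _] /=; last by rewrite eqxx tagged_asE.
by case: w => //= x w /negPf->.
Qed.

Lemma fp_tail_cons i (g : G i) w : no_head i w -> fp_tail i (fp_cons g w) = w.
Proof.
rewrite /fp_cons; case: eqP => [_|_ _] /=; last by rewrite eqxx.
by case: w => //= x w /negPf->.
Qed.

Lemma fp_consK i w : reduced w -> fp_cons (fp_head i w) (fp_tail i w) = w.
Proof.
case: w => [|[j h] w]; rewrite /fp_cons /=; first by rewrite eqxx.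
case/andP=> /andP[/= h1 _] _.
case: (eqVneq j i) => [ji|_]; last by rewrite eqxx.
by case: i / ji; rewrite tagged_asE (negPf h1).
Qed.

Lemma reduced_cons i (g : G i) w :
  no_head i w -> reduced w -> reduced (fp_cons g w).
Proof.
rewrite /fp_cons; case: ifPn => // g1; case: w => [|x w] /=.
  by rewrite /reduced /= g1.
by rewrite /reduced /= g1 eq_sym => -> /=.
Qed.

Lemma reduced_push i (g : G i) w : reduced w -> reduced (fp_push g w).
Proof.
by move=> rw; apply: reduced_cons; [exact: fp_no_head_tail|exact: reduced_tail].
Qed.

Lemma reduced_mulw w1 w2 : reduced w2 -> reduced (fp_mulw w1 w2).
Proof. by move=> r2; elim: w1 => //= x w; exact: reduced_push. Qed.

Lemma fp_push1 i w : reduced w -> fp_push (1 : G i) w = w.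
Proof. by move=> rw; rewrite /fp_push mul1g fp_consK. Qed.

Lemma fp_pushM i (g h : G i) w : reduced w ->
  fp_push g (fp_push h w) = fp_push (g * h) w.
Proof.
move=> rw; have nh := fp_no_head_tail i rw.
by rewrite {1}/fp_push {2 3}/fp_push fp_head_cons// fp_tail_cons// mulgA.
Qed.

Lemma fp_mulw_cons i (g : G i) w1 w2 : reduced w2 ->
  fp_mulw (fp_cons g w1) w2 = fp_push g (fp_mulw w1 w2).
Proof.
move=> r2; rewrite /fp_cons; case: eqP => // ->.
by rewrite fp_push1 //; exact: reduced_mulw.
Qed.

Lemma fp_mulw_push i (g : G i) w1 w2 : reduced w1 -> reduced w2 ->
  fp_mulw (fp_push g w1) w2 = fp_push g (fp_mulw w1 w2).
Proof.
move=> r1 r2; rewrite fp_mulw_cons// -fp_pushM; last exact: reduced_mulw.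
by rewrite -fp_mulw_cons// fp_consK.
Qed.

Lemma fp_mulwA w1 w2 w3 : reduced w2 -> reduced w3 ->
  fp_mulw w1 (fp_mulw w2 w3) = fp_mulw (fp_mulw w1 w2) w3.
Proof.
move=> r2 r3; elim: w1 => //= x w1 ->.
by rewrite fp_mulw_push//; exact: reduced_mulw.
Qed.

Lemma fp_mulw1 w : reduced w -> fp_mulw w [::] = w.
Proof.
elim: w => //= -[i g] w IHw; rewrite {1}/reduced /= => /andP[/andP[g1 aw] pw].
rewrite IHw; last by rewrite /reduced aw (path_sorted pw).
rewrite /fp_push /fp_cons.
case: w {IHw aw} pw => [|x w] /=; first by rewrite mulg1 (negPf g1).
by rewrite eq_sym => /andP[/negPf-> _]; rewrite mulg1 (negPf g1).
Qed.

Lemma reduced_invw w : reduced w -> reduced (fp_invw w).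
Proof.
case/andP=> aw sw; rewrite /reduced all_rev rev_sorted all_map sorted_map.
apply/andP; split; first by apply: sub_all aw => x /=; rewrite invg_eq1.
by apply: sub_sorted sw => x y /=; rewrite eq_sym.
Qed.

Lemma fp_invwK : involutive fp_invw.
Proof.
move=> w; rewrite /fp_invw map_rev revK -map_comp -[RHS]map_id.
by apply: eq_map => -[i g] /=; rewrite invgK.
Qed.

Lemma fp_mulVw w : reduced w -> fp_mulw (fp_invw w) w = [::].
Proof.
elim: w => //= -[i g] w IHw; rewrite {1}/reduced /= => /andP[/andP[g1 aw] pw].
rewrite /fp_invw map_cons rev_cons /fp_mulw foldr_rcons /= /fp_push /=.
rewrite eqxx tagged_asE mulVg /fp_cons eqxx.
by apply: IHw; rewrite /reduced aw (path_sorted pw).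
Qed.

Record free_product := FreeProduct {
  fp_word :> seq fp_letter;
  _ : reduced fp_word
}.
HB.instance Definition _ := [isSub for fp_word].
HB.instance Definition _ := [Choice of free_product by <:].

Lemma fp_wordP (u : free_product) : reduced (fp_word u).
Proof. by case: u. Qed.

Definition fp_one : free_product := @FreeProduct [::] isT.
Definition fp_mul (u v : free_product) : free_product :=
  FreeProduct (reduced_mulw u (fp_wordP v)).
Definition fp_inv (u : free_product) : free_product :=
  FreeProduct (reduced_invw (fp_wordP u)).

Lemma fp_mulA : associative fp_mul.
Proof. by move=> u v w; apply/val_inj/fp_mulwA; exact: fp_wordP. Qed.
Lemma fp_mul1g : left_id fp_one fp_mul.
Proof. by move=> u; exact/val_inj. Qed.
Lemma fp_mulg1 : right_id fp_one fp_mul.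
Proof. by move=> u; apply/val_inj/fp_mulw1/fp_wordP. Qed.
Lemma fp_mulVg : left_inverse fp_one fp_inv fp_mul.
Proof. by move=> u; apply/val_inj/fp_mulVw/fp_wordP. Qed.
Lemma fp_mulgV : right_inverse fp_one fp_inv fp_mul.
Proof.
move=> u; apply/val_inj; rewrite /= -{1}[fp_word u]fp_invwK.
exact/fp_mulVw/reduced_invw/fp_wordP.
Qed.

HB.instance Definition _ := isGroup.Build free_product
  fp_mulA fp_mul1g fp_mulg1 fp_mulVg fp_mulgV.

Lemma reduced_letter i (g : G i) : reduced (fp_cons g [::]).
Proof. exact: reduced_cons. Qed.

Definition fp_inj i (g : G i) : free_product := FreeProduct (reduced_letter g).

Lemma fp_injM i : {morph @fp_inj i : g h / g * h}.
Proof.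
move=> g h; apply/val_inj.
have push0 (k : G i) : fp_cons k [::] = fp_push k [::].
  by rewrite /fp_push mulg1.
rewrite [RHS]fp_mulw_cons; last exact: reduced_letter.
change (fp_cons (g * h) [::] = fp_push g (fp_cons h [::])).
by rewrite !push0 fp_pushM.
Qed.

End FreeProduct.

Local Open Scope classical_set_scope.
Local Open Scope ring_scope.

Section ProductMeasure.
Variable E : choiceType.

Definition cylinders : set (set (E -> bool)) :=
  [set A | exists e b, A = [set w | w e = b]].

Definition configuration : measurableType cylinders.-sigma :=
  g_sigma_algebraType cylinders.

(* The coordinates are independent Bernoulli(p) variables under P. *)
Definition is_bernoulli (R : realType) (p : R)
    (P : probability configuration R) : Prop :=
  forall (A : {fset E}) (c : E -> bool),
    P [set w | forall e, e \in A -> w e = c e] =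
    (\prod_(e <- A) bernoulli_pmf p (c e))%:E.

(* Well defined when E is countable and 0 <= p <= 1: see bernoulli_exists and
   bernoulli_unique below. *)
Definition bernoulli_measure (R : realType) (p : R) :
    probability configuration R :=
  xget point [set P | is_bernoulli p P].

Lemma bernoulli_unique (R : realType) (p : R)
    (P Q : probability configuration R) :
  is_bernoulli p P -> is_bernoulli p Q ->
  forall A : set configuration, measurable A -> P A = Q A.
Proof.
move=> HP HQ.
pose cyl (A : {fset E}) (c : E -> bool) : set configuration :=
  [set w | forall e, e \in A -> w e = c e].
pose G : set (set configuration) :=
  [set X | X = set0 \/ exists A c, X = cyl A c].
have mcyl A c : measurable (cyl A c).
  have -> : cyl A c = \bigcap_(e in [set` A]) [set w | w e = c e].
    by apply/seteqP; split=> w h e; exact: h.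
  apply: fin_bigcap_measurable; first exact: finite_fset.
  by move=> e _; apply: sub_sigma_algebra; exists e, (c e).
have GT : G setT.
  by right; exists fset0, (fun=> true); apply/seteqP; split.
have GI : setI_closed G.
  move=> _ _ [->|[A [c ->]]] [->|[B [d ->]]]; rewrite ?set0I ?setI0;
    try by left.
  have [AB|AB] := pselect (forall e, e \in A -> e \in B -> c e = d e).
    right; exists (A `|` B)%fset, (fun e => if e \in A then c e else d e).
    apply/seteqP; split=> w /=.
      move=> [hA hB] e; rewrite inE.
      by case: ifPn => [eA _|_ /= eB]; [exact: hA|exact: hB].
    move=> h; split=> e he; have := h e; rewrite inE he ?orbT => /(_ isT) ->//.
    by case: ifPn => // eA; exact: AB.
  left; apply/seteqP; split=> w //= [hA hB]; apply: AB => e eA eB.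
  by rewrite -(hA e eA) (hB e eB).
move=> A mA.
apply: (g_sigma_algebra_measure_unique G _ (fun=> setT)) => //.
- by move=> X [->|[B [c ->]]]; [exact: measurable0|exact: mcyl].
- by rewrite bigcup_const//; exists 0%N.
- move=> X [->|[B [c ->]]]; first by rewrite !measure0.
  by transitivity (\prod_(e <- B) bernoulli_pmf p (c e))%:E;
    [exact: HP|symmetry; exact: HQ].
- by move=> _; rewrite -ge0_fin_numE ?measure_ge0// fin_num_measure.
- suff cG : cylinders `<=` G by exact: (sub_sigma_algebra2 cG) mA.
  move=> X [e [b ->]]; right.
  exists [fset e]%fset, (fun=> b); apply/seteqP; split=> w /=.
    by move=> we e'; rewrite inE => /eqP ->.
  by move=> /(_ e); apply; rewrite inE.
Qed.

End ProductMeasure.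
Arguments cylinders : clear implicits.

(* Existence of the product measure, on a countable set of edges: the digits of
   a uniform x in [0, 1[ in the expansion splitting [0, 1[ at p. *)
Section BernoulliDigits.
Variables (R : realType) (p : R).
Hypothesis p01 : 0 <= p <= 1.

Let step (x : R) := if x < p then x / p else (x - p) / (1 - p).
Let digit k x := iter k step x < p.

Let digits_itv n (c : nat -> bool) :
  let l := \prod_(k < n) bernoulli_pmf p (c k) in
  exists a : R, [/\ 0 <= a, 0 <= l, a + l <= 1 &
    forall x, 0 <= x < 1 ->
      (forall k, (k < n)%N -> digit k x = c k) <-> a <= x < a + l].
Proof.
case/andP: p01 => p0 p1.
elim: n c => [|n IHn] c /=.
  by exists 0; rewrite big_ord0 add0r lexx ler01 lexx; split.
have [a [a0 l0 al1 H]] := IHn (fun k => c k.+1).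
rewrite big_ord_recl.
set l := \prod_(k < n) bernoulli_pmf p (c k.+1) in l0 al1 H *.
have digS x : (forall k, (k < n.+1)%N -> digit k x = c k) <->
    (x < p) = c 0%N /\ (forall k, (k < n)%N -> digit k (step x) = c k.+1).
  split=> [h|[h0 h] [|k] kn //].
    split=> [|k kn]; first by rewrite -(h 0%N).
    by rewrite -(h k.+1)// /digit iterSr.
  by rewrite -(h k)// /digit iterSr.
case: (c 0%N) digS => digS; rewrite /bernoulli_pmf.
- exists (p * a); split; [nra|nra|nra|] => x x01.
  rewrite digS; case: ltP => xp; last first.
    split=> [[]//|/andP[_ h]]; exfalso; nra.
  have pgt0 : 0 < p by case/andP: x01 => x0 _; exact: le_lt_trans xp.
  have x01' : 0 <= x / p < 1.
    by case/andP: x01 => x0 _; rewrite divr_ge0//= ltr_pdivrMr// mul1r.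
  rewrite /step xp.
  have -> : (p * a <= x < p * a + p * l) = (a <= x / p < a + l).
    by rewrite ler_pdivlMr// ltr_pdivrMr// -mulrDr mulrC (mulrC p).
  by rewrite -H//; split=> [[]|].
- exists (p + (1 - p) * a); split; [nra|nra|nra|] => x x01.
  rewrite digS; case: ltP => xp.
    split=> [[]//|/andP[h _]]; exfalso; nra.
  have pgt0 : 0 < 1 - p by case/andP: x01 => _ x1; lra.
  have x01' : 0 <= (x - p) / (1 - p) < 1.
    rewrite divr_ge0 ?subr_ge0//= ltr_pdivrMr// mul1r.
    by case/andP: x01 => _ x1; lra.
  rewrite /step ltNge xp /=.
  have -> : (p + (1 - p) * a <= x < p + (1 - p) * a + (1 - p) * l) =
            (a <= (x - p) / (1 - p) < a + l).
    rewrite ler_pdivlMr// ltr_pdivrMr//.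
    by congr andb; apply/idP/idP; nra.
  by rewrite -H//; split=> [[]|].
Qed.

Let measurable_digit k b : measurable [set x | digit k x = b].
Proof.
have mstep j : measurable_fun setT (iter j step).
  elim: j => [|j IHj] /=; first exact: measurable_id.
  apply: (measurableT_comp _ IHj); rewrite /step.
  apply: measurable_fun_ifT => /=.
  - exact: measurable_fun_ltr.
  - exact: measurable_funM.
  - by apply: measurable_funM => //; exact: measurable_funB.
have : measurable_fun setT (digit k) by apply: measurable_fun_ltr.
by move=> /(_ measurableT [set b]); rewrite setTI; exact.
Qed.

Let mu := mrestr (@lebesgue_measure R) (measurable_itv `[0%R, 1%R[).

Let mu_full n (c : nat -> bool) :
  mu [set x | forall k, (k < n)%N -> digit k x = c k] =
  (\prod_(k < n) bernoulli_pmf p (c k))%:E.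
Proof.
have [a [a0 l0 al1 H]] := digits_itv n c.
rewrite /mu /mrestr; set l := \prod_(k < n) _ in l0 al1 H *.
rewrite (_ : _ `&` _ = [set` `[a, a + l[]); last first.
  apply/seteqP; split=> x /=; rewrite !in_itv /=.
    by move=> [h x01]; apply/H.
  move=> xal; have x01 : 0 <= x < 1 by lra.
  by split=> //; apply/H.
rewrite lebesgue_measure_itv /= lte_fin; case: ltP => h.
  by rewrite -EFinD addrAC subrr add0r.
by congr EFin; lra.
Qed.

Let wt (b : option bool) := if b is Some b then bernoulli_pmf p b else 1.
Let ok (b : option bool) (d : bool) := if b is Some b then d = b else True.

Let mu_partial n (c : nat -> option bool) :
  mu [set x | forall k, (k < n)%N -> ok (c k) (digit k x)] =
  (\prod_(k < n) wt (c k))%:E.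
Proof.
have mC m (d : nat -> option bool) :
    measurable [set x | forall k, (k < m)%N -> ok (d k) (digit k x)].
  rewrite (_ : [set x | _] =
      \bigcap_(k in [set k | (k < m)%N]) [set x | ok (d k) (digit k x)]).
    apply: bigcap_measurableType => k _; case: (d k) => [b|] /=.
      exact: measurable_digit.
    exact: measurableT.
  by apply/seteqP; split=> x /= h k; exact: h.
suff IH j : forall c : nat -> option bool,
    (forall k, (j <= k < n)%N -> c k != None) ->
  mu [set x | forall k, (k < n)%N -> ok (c k) (digit k x)] =
  (\prod_(k < n) wt (c k))%:E.
  apply: (IH n) => k /andP[nk kn].
  by have := leq_ltn_trans nk kn; rewrite ltnn.
elim: j => [|j IHj] {}c hc.
  have cE k : (k < n)%N -> c k = Some (odflt true (c k)).
    by move=> kn; move: (hc k kn); case: (c k).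
  rewrite (eq_bigr (fun k : 'I_n => bernoulli_pmf p (odflt true (c k))));
    last by move=> k _; rewrite (cE k).
  rewrite -(mu_full n (fun k => odflt true (c k))).
  congr mu; apply/seteqP; split=> x /= h k kn.
    by have := h k kn; rewrite cE.
  by have := h k kn; rewrite [in ok _ _]cE.
case: (ltnP j n) => jn; last first.
  apply: IHj => k /andP[jk kn].
  by move: (leq_ltn_trans jk kn); rewrite ltnNge jn.
case cj: (c j) => [b|].
  apply: IHj => k /andP[]; rewrite leq_eqVlt => /predU1P[<-|jk kn].
    by rewrite cj.
  by apply: hc; rewrite jk.
pose d b k := if k == j then Some b else c k.
have dS b : mu [set x | forall k, (k < n)%N -> ok (d b k) (digit k x)] =
    (\prod_(k < n) wt (d b k))%:E.
  apply: IHj => k /andP[jk kn]; rewrite /d; have [_//|kj] := eqVneq k j.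
  by apply: hc; rewrite kn andbT ltn_neqAle eq_sym kj.
rewrite (_ : [set x | _] =
    [set x | forall k, (k < n)%N -> ok (d true k) (digit k x)] `|`
    [set x | forall k, (k < n)%N -> ok (d false k) (digit k x)]); last first.
  apply/seteqP; split=> x /=.
    move=> h; case dj: (digit j x); [left|right] => k kn; rewrite /d;
      by case: eqP => [->|_]; rewrite ?dj//; exact: h.
  move=> [] h k kn; have := h k kn; rewrite /d; case: eqP => // ->;
    by rewrite cj.
rewrite /mu measureU //; [|exact: mC|exact: mC|]; last first.
  apply/seteqP; split=> x //= [/(_ j jn) + /(_ j jn)].
  by rewrite /d eqxx /= => ->.
have dE b : \prod_(k < n) wt (d b k) =
    bernoulli_pmf p b * \prod_(k < n | k != Ordinal jn) wt (c k).
  rewrite (bigD1 (Ordinal jn))//= /d eqxx; congr *%R.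
  by apply: eq_bigr => k /negPf; rewrite -val_eqE /= => ->.
transitivity (mu [set x | forall k, (k < n)%N -> ok (d true k) (digit k x)] +
   mu [set x | forall k, (k < n)%N -> ok (d false k) (digit k x)])%E;
  first by [].
rewrite !dS !dE [in RHS](bigD1 (Ordinal jn))//= cj mul1r -EFinD -mulrDl.
by rewrite /bernoulli_pmf addrC subrK mul1r.
Qed.

Lemma bernoulli_exists (E : choiceType) : countable [set: E] ->
  exists P : probability (configuration E) R, is_bernoulli p P.
Proof.
move=> /countable_injP[f finj].
have {}finj : injective f by move=> x y; apply: finj; rewrite inE.
pose phi (x : measurableTypeR R) : configuration E := fun e => digit (f e) x.
have mphi : measurable_fun setT phi.
  have := @measurability _ _ (measurableTypeR R) (configuration E) setT phi
    (cylinders E).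
  move=> h; apply: h => // _ [_ [e [b ->]] <-].
  by rewrite setTI; exact: measurable_digit.
have mu1 : mu setT = 1%E.
  rewrite /mu /mrestr setTI lebesgue_measure_itv /=.
  by rewrite lte_fin ltr01 oppr0 adde0.
pose mu' : {measure set (measurableTypeR R) -> \bar R} :=
  mrestr (@lebesgue_measure R) (measurable_itv `[0%R, 1%R[).
pose P0 : probability (measurableTypeR R) R :=
  HB.pack (Measure.sort mu')
    (Measure_isProbability.Build _ _ R (Measure.sort mu') mu1).
pose X : {mfun measurableTypeR R >-> configuration E} :=
  HB.pack phi (isMeasurableFun.Build _ _ _ _ phi mphi).
exists (distribution P0 X) => A c.
pose c' k := omap (fun e : A => c (val e)) [pick e : A | f (val e) == k].
have c'f e : e \in A -> c' (f e) = Some (c e).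
  move=> eA; rewrite /c'; case: pickP => [e' /eqP/finj <-//|].
  by move=> /(_ [` eA]%fset) /=; rewrite eqxx.
have c'N k : k \notin [seq f e | e <- A] -> c' k = None.
  rewrite /c'; case: pickP => // e /eqP <- /negP[]; apply: map_f; exact: valP.
pose n := (\max_(e <- A) f e).+1.
have fn e : e \in A -> (f e < n)%N by move=> eA; rewrite ltnS leq_bigmax_seq.
transitivity (mu [set x | forall k, (k < n)%N -> ok (c' k) (digit k x)]).
  congr mu; apply/seteqP; split=> x /= h.
    move=> k kn.
    have [/mapP[e eA ->]|/c'N->//] := boolP (k \in [seq f e | e <- A]).
    by rewrite c'f//; exact: h.
  by move=> e eA; have := h _ (fn _ eA); rewrite c'f.
rewrite mu_partial; congr EFin.
transitivity (\prod_(k <- [seq f e | e <- A]) wt (c' k)); last first.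
  by rewrite big_map; apply: eq_big_seq => e eA; rewrite c'f.
rewrite -(big_mkord xpredT (fun k => wt (c' k))).
rewrite (bigID [pred k | k \in [seq f e | e <- A]])/=.
rewrite [X in _ * X]big1 ?mulr1; last by move=> k /c'N ->.
rewrite -big_filter; apply: perm_big; apply: uniq_perm.
- by rewrite filter_uniq// iota_uniq.
- by rewrite map_inj_uniq.
- move=> k; rewrite mem_filter mem_index_iota leq0n andTb.
  apply: andb_idr => /mapP[e eA ->]; exact: fn.
Qed.
End BernoulliDigits.

Section CayleyPercolation.
Local Open Scope group_scope.
Variables (G : groupType) (S : {fset G}).

Definition generates : Prop :=
  forall H : {pred G}, group_closed H -> {subset S <= H} -> forall g, g \in H.

(* The edge (g, s) joins g and g * s; loops and parallel edges are kept. *)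
Definition cayley_edge : choiceType := (G * S)%type.

Local Notation configuration := (configuration cayley_edge).

Definition open_adj (w : configuration) : rel G := fun x y =>
  [exists s : S, w (x, s) && (y == x * val s) || w (y, s) && (x == y * val s)].

Definition cluster (w : configuration) : set G :=
  [set x | exists2 q, path (open_adj w) 1 q & x = last 1 q].

Lemma countable_cayley_edge : generates -> countable [set: cayley_edge].
Proof.
move=> genS.
pose letter (x : S * bool) : G := if x.2 then val x.1 else (val x.1)^-1.
pose ev (u : seq (S * bool)) : G := \prod_(x <- u) letter x.
pose H : {pred G} := fun g => `[< exists u, g = ev u >].
have evV u : (ev u)^-1 = ev (rev [seq (x.1, ~~ x.2) | x <- u]).
  rewrite /ev; elim: u => [|[s b] u IHu]; first by rewrite !big_nil invg1.
  rewrite big_cons /= rev_cons -cats1 big_cat/= -IHu big_seq1 invgM.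
  by congr (_ * _); case: b; rewrite /letter/= ?invgK.
have evH g : exists u, g = ev u.
  apply/asboolP; apply: (genS H) => {g} [|s sS].
    split; first by apply/asboolP; exists [::]; rewrite /ev big_nil.
    move=> _ _ /asboolP[u ->] /asboolP[v ->]; apply/asboolP.
    by rewrite evV /ev -big_cat; eexists.
  by apply/asboolP; exists [:: ([` sS]%fset, true)]; rewrite /ev big_seq1.
pose f (x : seq (S * bool) * S) : cayley_edge := (ev x.1, x.2).
have fsurj : [set: cayley_edge] `<=` f @` setT.
  by move=> [g s] _; have [u ->] := evH g; exists (u, s).
apply: sub_countable (subset_card_le fsurj) _.
by apply: sub_countable (card_image_le _ _) _; exact: countableP.
Qed.

Variable R : realType.
Implicit Type p : R.
Local Open Scope ereal_scope.

Definition percolation p : probability configuration R :=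
  bernoulli_measure cayley_edge p.

Definition theta p : \bar R :=
  percolation p [set w | infinite_set (cluster w)].

Definition critical_probability : R :=
  inf [set p : R | (0 <= p <= 1)%R /\ 0 < theta p].

Definition mean_cluster_size p : \bar R :=
  \int[percolation p]_w counting (cluster w).

Lemma percolationP p : generates -> (0 <= p <= 1)%R ->
  is_bernoulli p (percolation p).
Proof.
move=> genS p01; apply: (xgetPex point).
exact/bernoulli_exists/countable_cayley_edge.
Qed.

End CayleyPercolation.

Definition free_product_gens (n : nat) (G : 'I_n -> groupType)
    (S : forall i, {fset G i}) : {fset free_product G} :=
  (\bigcup_(i <- enum 'I_n) (@fp_inj _ G i @` S i))%fset.

(* Main.v *)
Require Import Defs.
From mathcomp Require Import all_boot all_order all_algebra.
From mathcomp Require Import finmap all_classical all_reals all_analysis.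
From mathcomp Require Import measurable_realfun ring lra.
Import Order.TTheory GRing.Theory Num.Theory.
Import numFieldNormedType.Exports.
(* Again, because topology has a [cluster] as well. *)
Import Defs.
Local Open Scope classical_set_scope.
Local Open Scope ring_scope.
Set Implicit Arguments.
Unset Strict Implicit.
Unset Printing Implicit Defensive.

(** Every vertex of the Cayley graph of the free product is a cut vertex between
    the cosets meeting there, and percolation is independent on distinct cosets.
    Hence the reduced word [g_1 ... g_k] is in the cluster with probability the
    product of the probabilities that [g_j] is in the cluster of its own factor,
    and the mean cluster size is a sum over reduced words. Splitting off the
    first letter gives [x = chi_i * t_i] and [x = 1 + sum_i (x - t_i)], where
    [t_i] is the sum over words not starting in the factor [i]; eliminating the
    [t_i] gives the formula whenever [x] is finite.

    Put [a_i = chi_i - 1], cut down to finitely many letters of each factor. If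
    [sum_i a_i / (1 + a_i) > 1], then the number of words of length [k] in the
    cluster, suitably weighted, has mean 1 and second moment bounded uniformly in
    [k], so the cluster is infinite with positive probability. If the sum is at
    most 1 for all finite choices at some larger parameter, then by strict
    monotonicity it is uniformly below 1 at [p], and the sum over words is finite.
    Hence [x] is finite below the critical point. Conversely, in any Cayley graph
    a finite mean persists for slightly larger parameters, by the finite-volume
    criterion of Simon-Lieb and Duminil-Copin-Tassion: the expected number of
    exits from some finite set is below 1. *)

(** * Bernoulli configurations *)

Definition image_measure d d' (T : measurableType d) (T' : measurableType d')
    (R : realType) (m : {measure set T -> \bar R}) (f : T -> T')
    (mf : measurable_fun setT f) : {measure set T' -> \bar R} :=
  measure_function_pushforward__canonical__measure_function_Measure m mf.

Section Configurations.
Variables (R : realType).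
Implicit Types (E : choiceType) (p : R).

Definition constant_on E (A : {fset E}) (b : bool) : set (configuration E) :=
  [set w | forall e, e \in A -> w e = b].

Lemma measurable_coord E (e : E) (b : bool) :
  measurable ([set w | w e = b] : set (configuration E)).
Proof. by apply: sub_sigma_algebra; exists e, b. Qed.

Lemma measurable_coord1 E (e : E) (b : bool) : measurable
  [set w : configuration E * configuration E | w.1 e = b].
Proof.
rewrite -[X in measurable X]setTI.
exact: (@measurable_fst _ _ (configuration E) (configuration E) measurableT
  [set w | w e = b] (measurable_coord e b)).
Qed.

Lemma measurable_coord2 E (e : E) (b : bool) : measurable
  [set w : configuration E * configuration E | w.2 e = b].
Proof.
rewrite -[X in measurable X]setTI.
exact: (@measurable_snd _ _ (configuration E) (configuration E) measurableT
  [set w | w e = b] (measurable_coord e b)).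
Qed.

Lemma measurable_constant_on E (A : {fset E}) b :
  measurable (constant_on A b).
Proof.
have -> : constant_on A b = \bigcap_(e in [set` A]) [set w | w e = b].
  by apply/seteqP; split=> w h e; exact: h.
apply: fin_bigcap_measurable; first exact: finite_fset.
by move=> e _; exact: measurable_coord.
Qed.

(** For a fixed [b] the sets [constant_on A b] are closed under intersection, which takes the union
    of the index sets. Complements of the single-edge ones give all coordinate events, so they
    generate the sigma-algebra. *)
Lemma eq_measure_constant_on E b
    (m1 m2 : {measure set (configuration E) -> \bar R}) :
  (m1 setT < +oo)%E ->
  (forall A, m1 (constant_on A b) = m2 (constant_on A b)) ->
  forall A, measurable A -> m1 A = m2 A.
Proof.
move=> m1oo m12 A mA.
pose G : set (set (configuration E)) := [set X | exists A, X = constant_on A b].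
have GT : G setT by exists fset0; apply/seteqP; split.
have Gm : G `<=` measurable by move=> _ [B ->]; exact: measurable_constant_on.
have GI : setI_closed G.
  move=> _ _ [B ->] [C ->]; exists (B `|` C)%fset; apply/seteqP; split=> w /=.
    by move=> [hB hC] e; rewrite inE => /orP[/hB|/hC].
  by move=> h; split=> e eB; apply: h; rewrite inE eB ?orbT.
apply: (g_sigma_algebra_measure_unique G _ (fun=> setT)) => //.
- by rewrite bigcup_const//; exists 0%N.
- by move=> _ [B ->]; exact: m12.
have cG : cylinders E `<=` <<s G >>.
  move=> _ [e [c ->]].
  have Ge : <<s G >> [set w | w e = b].
    apply: sub_sigma_algebra; exists [fset e]%fset; apply/seteqP; split=> w /=.
      by move=> we e'; rewrite inE => /eqP ->.
    by move=> /(_ e); apply; rewrite inE.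
  have [->//|cb] := eqVneq c b.
  rewrite (_ : [set w | _] = setT `\` [set w | w e = b]).
    by apply: sigma_algebraCD.
  apply/seteqP; split=> w /=.
    by move=> we; split=> // wb; move: cb; rewrite -we wb eqxx.
  by move=> [_]; case: (w e) (c) (b) cb => [] [] [].
by apply: (smallest_sub _ cG) mA; exact: smallest_sigma_algebra.
Qed.

Lemma measurable_fun_configuration d (T : measurableType d) E
    (f : T -> configuration E) :
  (forall e b, measurable [set x | f x e = b]) -> measurable_fun setT f.
Proof.
move=> mf; have := @measurability _ _ T (configuration E) setT f (cylinders E).
by apply => // _ [_ [e [b ->]] <-]; rewrite setTI; exact: mf.
Qed.

Lemma is_bernoulli_constant_on E p (P : probability (configuration E) R) :
  is_bernoulli p P ->
  forall A b, P (constant_on A b) = (bernoulli_pmf p b ^+ #|` A|)%:E.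
Proof.
move=> HP A b; transitivity (\prod_(e <- A) bernoulli_pmf p b)%:E.
  exact: (HP A (fun=> b)).
by rewrite big_const_seq count_predT -Monoid.iteropE.
Qed.

Definition relabel E E' (f : E' -> E) (w : configuration E) :
  configuration E' := fun e => w (f e).

Lemma measurable_relabel E E' (f : E' -> E) : measurable_fun setT (relabel f).
Proof.
by apply: measurable_fun_configuration => e b; exact: measurable_coord.
Qed.

(** An injective [f] preserves the number of edges required to be open, and this number alone
    determines both probabilities. It is applied to translations and to the embeddings of factor
    graphs as cosets. *)
Lemma bernoulli_relabel E E' (f : E' -> E) p
    (P : probability (configuration E) R)
    (P' : probability (configuration E') R) :
  injective f -> is_bernoulli p P -> is_bernoulli p P' ->
  forall A : set (configuration E'), measurable A ->
    P (relabel f @^-1` A) = P' A.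
Proof.
move=> finj HP HP' A mA.
have mF := measurable_relabel f.
pose Q := image_measure P mF.
change (Q A = P' A).
apply: (eq_measure_constant_on (b := true)) => //.
  change (P setT < +oo)%E; by rewrite probability_setT ltry.
move=> B; apply: etrans (esym (is_bernoulli_constant_on HP' B true)).
have <- : #|` [fset f e | e in B]%fset| = #|` B|.
  by rewrite card_imfset.
rewrite -(is_bernoulli_constant_on HP); congr (P _).
apply/seteqP; split=> w /= h e.
  by move=> /imfsetP[e' /= eB ->]; exact: h.
by move=> eB; apply: h; apply/imfsetP; exists e.
Qed.

Section Mix.
Variables (E : choiceType) (p : R) (P : probability (configuration E) R).
Hypothesis HP : is_bernoulli p P.

(* Mixing two independent configurations along [D] preserves the law, so that
   events determined on [D] and off [D] can be read off different copies. *)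
Lemma bernoulli_independent (D : set E) (A B : set (configuration E)) :
  measurable A -> measurable B ->
  (forall w w' : configuration E,
     (forall e, D e -> w e = w' e) -> A w -> A w') ->
  (forall w w' : configuration E,
     (forall e, ~ D e -> w e = w' e) -> B w -> B w') ->
  P (A `&` B) = (P A * P B)%E.
Proof.
move=> mA mB hA hB.
pose F (w : configuration E * configuration E) : configuration E :=
  fun e => if `[< D e >] then w.1 e else w.2 e.
have mF : measurable_fun setT F.
  apply: measurable_fun_configuration => e b; rewrite /F.
  by case: asboolP => De; [exact: measurable_coord1|exact: measurable_coord2].
pose Q := image_measure (P \x P)%E mF.
have -> : P (A `&` B) = Q (A `&` B).
  apply: (@eq_measure_constant_on E true P Q); last exact: measurableI.
    by change (P setT < +oo)%E; rewrite probability_setT ltry.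
  move=> C; pose C1 := [fset e in C | `[< D e >]]%fset.
  pose C2 := [fset e in C | ~~ `[< D e >]]%fset.
  rewrite (_ : Q _ = (P \x P)%E (constant_on C1 true `*` constant_on C2 true)).
    rewrite product_measure1E; [|exact: measurable_constant_on..].
    apply: etrans (is_bernoulli_constant_on HP C true) _.
    apply/esym; apply: (etrans (congr2 _ (is_bernoulli_constant_on HP C1 true)
      (is_bernoulli_constant_on HP C2 true))).
    rewrite -EFinM -exprD; congr ((_ ^+ _)%:E).
    have -> : C = (C1 `|` C2)%fset.
      by apply/fsetP => e; rewrite !inE -andb_orr orbN andbT.
    rewrite cardfsU (_ : (_ `&` _)%fset = fset0) ?cardfs0 ?subn0//.
    by apply/fsetP => e; rewrite !inE; case: (`[< D e >]); rewrite ?andbF.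
  congr ((P \x P)%E _); apply/seteqP; split=> -[w1 w2] /=.
    move=> h; split=> e /=; rewrite !inE => /andP[eC De]; have := h e eC;
      by rewrite /F ?De// (negPf De).
  move=> [h1 h2] e eC; rewrite /F; case: ifPn => De.
    by apply: h1; rewrite !inE eC.
  by apply: h2; rewrite !inE eC.
apply: (etrans _ (product_measure1E P P mA mB)); congr ((P \x P)%E _).
apply/seteqP; split=> -[w1 w2] /= [Aw Bw]; split.
- by apply: hA Aw => e De; rewrite /F asboolT.
- by apply: hB Bw => e De; rewrite /F asboolF.
- by apply: hA Aw => e De; rewrite /F asboolT.
- by apply: hB Bw => e De; rewrite /F asboolF.
Qed.

End Mix.

Definition sprinkle E (w : configuration E * configuration E) :
  configuration E := fun e => w.1 e || w.2 e.

Lemma measurable_sprinkle E : measurable_fun setT (@sprinkle E).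
Proof.
apply: measurable_fun_configuration => e b; rewrite /sprinkle; case: b.
  rewrite (_ : [set x | _] = [set w | w.1 e = true] `|` [set w | w.2 e = true]).
    by apply: measurableU; [exact: measurable_coord1|exact: measurable_coord2].
  by apply/seteqP; split=> w /= => [/orP|] // [->|->]; rewrite ?orbT.
rewrite (_ : [set x | _] = [set w | w.1 e = false] `&` [set w | w.2 e = false]).
  by apply: measurableI; [exact: measurable_coord1|exact: measurable_coord2].
by apply/seteqP; split=> w /= => [/norP[/negPf-> /negPf->]|[-> ->]].
Qed.

(** An edge is closed in the union exactly when it is closed in both independent copies, so the
    probabilities of being closed multiply; hence the comparison on events with value [false]. *)
Lemma bernoulli_sprinkle E p q eps (P Pe Q : probability (configuration E) R) :
  is_bernoulli p P -> is_bernoulli eps Pe -> is_bernoulli q Q ->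
  1 - q = (1 - p) * (1 - eps) ->
  forall A, measurable A -> Q A = (P \x Pe)%E (@sprinkle E @^-1` A).
Proof.
move=> HP He HQ pq A mA; have mF := @measurable_sprinkle E.
pose Q' := image_measure (P \x Pe)%E mF.
change (Q A = Q' A); apply: (eq_measure_constant_on (b := false)) => //.
  by change (Q setT < +oo)%E; rewrite probability_setT ltry.
move=> B; rewrite (_ : Q' _ =
    (P \x Pe)%E (constant_on B false `*` constant_on B false)).
  rewrite product_measure1E; [|exact: measurable_constant_on..].
  apply: etrans (is_bernoulli_constant_on HQ B false) _.
  apply/esym; apply: (etrans (congr2 _ (is_bernoulli_constant_on HP B false)
    (is_bernoulli_constant_on He B false))).
  by rewrite -EFinM -exprMn /bernoulli_pmf/= pq.
congr ((P \x Pe)%E _); apply/seteqP; split=> -[w1 w2] /=.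
  by move=> h; split=> e /h /norP[/= /negPf h1 /negPf h2].
by move=> [h1 h2] e eB; rewrite /sprinkle /= h1 ?h2.
Qed.

End Configurations.

(** * Clusters in Cayley graphs *)

Section RealProbability.
Context d (T : measurableType d) (R : realType) (P : probability T R).
Implicit Types A B : set T.

Definition Pr A : R := fine (P A).

Lemma PrE A : measurable A -> P A = (Pr A)%:E.
Proof. by move=> mA; rewrite fineK// fin_num_measure. Qed.

Lemma Pr_ge0 A : 0 <= Pr A.
Proof. exact: fine_ge0. Qed.

Lemma le_Pr A B : measurable A -> measurable B -> A `<=` B -> Pr A <= Pr B.
Proof.
by move=> mA mB AB; rewrite -lee_fin -!PrE//; apply: le_measure; rewrite ?inE.
Qed.

Lemma Pr_le1 A : measurable A -> Pr A <= 1.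
Proof. by move=> mA; rewrite -lee_fin -PrE//; exact: probability_le1. Qed.

Lemma measurable_bigcup_seq (I : eqType) (r : seq I) (F : I -> set T) :
  (forall i, measurable (F i)) ->
  measurable [set w | exists2 i, i \in r & F i w].
Proof.
move=> mF; elim: r => [|i r IHr].
  rewrite (_ : [set _ | _] = set0)//.
  by apply/seteqP; split=> w // [].
rewrite (_ : [set _ | _] = F i `|` [set w | exists2 i, i \in r & F i w]).
  exact: measurableU.
apply/seteqP; split=> w /=.
  by move=> [j]; rewrite inE => /predU1P[->|jr]; [left|right; exists j].
move=> [Fi|[j jr Fj]]; [exists i => //|exists j => //]; rewrite inE ?eqxx//.
by rewrite jr orbT.
Qed.

Lemma Pr_sub_sum (I : eqType) (r : seq I) A (F : I -> set T) :
  measurable A -> (forall i, measurable (F i)) ->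
  (forall w, A w -> exists2 i, i \in r & F i w) ->
  Pr A <= \sum_(i <- r) Pr (F i).
Proof.
move=> mA mF; elim: r => [|i r IHr] in A mA *.
  rewrite big_nil => AF; rewrite (_ : A = set0) ?/Pr ?measure0//.
  by apply/seteqP; split=> // w /AF[].
move=> AF; rewrite big_cons.
have mD : measurable (A `\` F i) by exact: measurableD.
apply: le_trans (_ : Pr (F i) + Pr (A `\` F i) <= _); last first.
  rewrite lerD2l; apply: IHr => // w [/AF[j]].
  by rewrite inE => /predU1P[->//|jr] Fj _; exists j.
rewrite -lee_fin EFinD -!PrE//.
apply: le_trans (measureU2 P (mF i) mD); apply: le_measure; rewrite ?inE//.
  exact: measurableU.
by move=> w Aw; have [Fi|Fi] := pselect (F i w); [left|right].
Qed.

Lemma Pr_sum_disjoint (I : eqType) (r : seq I) A (F : I -> set T) :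
  measurable A -> (forall i, measurable (F i)) -> uniq r ->
  (forall i, i \in r -> F i `<=` A) ->
  {in r &, forall i j w, F i w -> F j w -> i = j} ->
  \sum_(i <- r) Pr (F i) <= Pr A.
Proof.
move=> mA mF ur FA tF; elim: r => [|i r IHr] in A mA ur FA tF *.
  by rewrite big_nil Pr_ge0.
case/andP: ur => ir ur; rewrite big_cons.
have mD : measurable (A `\` F i) by exact: measurableD.
apply: le_trans (_ : Pr (F i) + Pr (A `\` F i) <= _).
  rewrite lerD2l; apply: IHr => // [j jr w Fj|j k jr kr]; last first.
    by apply: tF; rewrite inE ?jr ?kr orbT.
  split; first by apply: FA Fj; rewrite inE jr orbT.
  move=> Fi; move: ir; rewrite (tF _ _ _ _ _ Fi Fj) ?jr// inE ?eqxx//.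
  by rewrite jr orbT.
rewrite -lee_fin EFinD -!PrE// -measureU//; last first.
  by apply/seteqP; split=> // w [Fi []].
apply: le_measure; rewrite ?inE//; first exact: measurableU.
by move=> w [|[]//]; apply: FA; rewrite inE eqxx.
Qed.

Section SecondMomentMethod.
Variables (I : eqType) (F : I -> set T) (c : I -> R).
Hypothesis mF : forall i, measurable (F i).

(* The expectation over [B] of the square of [a + \sum_i c i 1_(F i)]. *)
Let square_mean (r : seq I) a B := a ^+ 2 * Pr B +
  2 * a * (\sum_(i <- r) c i * Pr (B `&` F i)) +
  \sum_(i <- r) \sum_(j <- r) c i * c j * Pr (B `&` (F i `&` F j)).

(** Splitting [B] along [F i] writes the expression as a sum of two of the same kind for the
    remaining events: with constant [a + c i] inside [F i] and [a] outside. The base case is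
    [a ^+ 2 * Pr B]. *)
Let square_mean_ge0 r a B : measurable B -> 0 <= square_mean r a B.
Proof.
elim: r a B => [|i r IHr] a B mB; rewrite /square_mean.
  by rewrite !big_nil mulr0 !addr0 mulr_ge0 ?sqr_ge0 ?Pr_ge0.
have mB1 : measurable (B `&` F i) by exact: measurableI.
have mB2 : measurable (B `\` F i) by exact: measurableD.
have split_Pr X : measurable X ->
    Pr (B `&` X) = Pr (B `&` F i `&` X) + Pr ((B `\` F i) `&` X).
  move=> mX; apply: EFin_inj; rewrite EFinD -!PrE//; [|exact: measurableI..].
  rewrite -measureU//; [|exact: measurableI|exact: measurableI|].
    congr (P _); apply/seteqP; split=> w /=; last by move=> [[[]]|[[]]].
    by move=> [Bw Xw]; have [Fw|Fw] := pselect (F i w); [left|right].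
  by apply/seteqP; split=> w //= [[[_ Fw] _] [[_ ]]].
have := addr_ge0 (IHr (a + c i) _ mB1) (IHr a _ mB2).
rewrite /square_mean !big_cons /=.
have -> : \sum_(j <- r) \sum_(k <- i :: r) c j * c k * Pr (B `&` (F j `&` F k)) =
    c i * (\sum_(j <- r) c j * Pr (B `&` F i `&` F j)) +
    \sum_(j <- r) \sum_(k <- r) c j * c k * Pr (B `&` (F j `&` F k)).
  rewrite mulr_sumr -big_split/=; apply: eq_bigr => j _.
  by rewrite big_cons [F j `&` F i]setIC setIA; congr +%R; ring.
have -> : \sum_(j <- r) c i * c j * Pr (B `&` (F i `&` F j)) =
    c i * (\sum_(j <- r) c j * Pr (B `&` F i `&` F j)).
  by rewrite mulr_sumr; apply: eq_bigr => j _; rewrite setIA mulrA.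
have -> : Pr B = Pr (B `&` F i) + Pr (B `\` F i).
  by rewrite -[B in LHS]setIT split_Pr// !setIT.
rewrite setIid.
have -> : \sum_(j <- r) c j * Pr (B `&` F j) =
    \sum_(j <- r) c j * Pr (B `&` F i `&` F j) +
    \sum_(j <- r) c j * Pr ((B `\` F i) `&` F j).
  by rewrite -big_split/=; apply: eq_bigr => j _; rewrite split_Pr// mulrDr.
have -> : \sum_(j <- r) \sum_(k <- r) c j * c k * Pr (B `&` (F j `&` F k)) =
    \sum_(j <- r) \sum_(k <- r) c j * c k * Pr (B `&` F i `&` (F j `&` F k)) +
    \sum_(j <- r) \sum_(k <- r) c j * c k * Pr ((B `\` F i) `&` (F j `&` F k)).
  rewrite -big_split/=; apply: eq_bigr => j _; rewrite -big_split/=.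
  apply: eq_bigr => k _; rewrite split_Pr ?mulrDr//; exact: measurableI.
by move=> h; apply: (le_trans h); rewrite le_eqVlt; apply/predU1P; left; ring.
Qed.

(** On the union [U] of the events, the mean square of the weighted count minus [K] is
    [K ^+ 2 * Pr U - 2 * K] plus the second moment, which is at most [K]. Nonnegativity then gives
    the bound. *)
Lemma second_moment_method (r : seq I) K : 0 < K ->
  \sum_(i <- r) c i * Pr (F i) = 1 ->
  \sum_(i <- r) \sum_(j <- r) c i * c j * Pr (F i `&` F j) <= K ->
  K^-1 <= Pr [set w | exists2 i, i \in r & F i w].
Proof.
move=> K0 m1 m2; set U := [set w | _].
have mU : measurable U by exact: measurable_bigcup_seq.
have FU i : i \in r -> U `&` F i = F i.
  by move=> ir; apply/setIidPr => w Fw; exists i.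
have := square_mean_ge0 r (- K) mU; rewrite /square_mean.
have -> : \sum_(i <- r) c i * Pr (U `&` F i) = 1.
  by rewrite -m1; apply: eq_big_seq => i ir; rewrite FU.
have -> : \sum_(i <- r) \sum_(j <- r) c i * c j * Pr (U `&` (F i `&` F j)) =
    \sum_(i <- r) \sum_(j <- r) c i * c j * Pr (F i `&` F j).
  by apply: eq_big_seq => i ir; apply: eq_bigr => j _; rewrite setIA FU.
move=> h; rewrite -(ler_pM2l K0) mulfV ?gt_eqF// -(ler_pM2l K0) mulr1 mulrA.
by move: h m2; set M := \sum_(i <- r) _; nra.
Qed.

End SecondMomentMethod.

End RealProbability.

(** * Clusters as closures along open edges, and their measurability *)

Section Clusters.
Variables (G : groupType) (S : {fset G}).
Local Notation configuration := (configuration (cayley_edge S)).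
Implicit Types (w : configuration) (x y : G) (s : S).
Local Open Scope group_scope.

Lemma cluster1 w : cluster w 1.
Proof. by exists [::]. Qed.

Lemma open_adjP w x y : reflect
  (exists s, w (x, s) /\ y = x * val s \/ w (y, s) /\ x = y * val s)
  (open_adj w x y).
Proof.
apply: (iffP existsP) => -[s].
  by case/orP=> /andP[ws /eqP e]; exists s; [left|right].
move=> h; exists s; apply/orP; case: h => -[ws e].
  by left; rewrite ws; apply/eqP.
by right; rewrite ws; apply/eqP.
Qed.

Lemma cluster_adj w x y : cluster w x -> open_adj w x y -> cluster w y.
Proof.
move=> [q pq xq] xy; exists (rcons q y); last by rewrite last_rcons.
by rewrite rcons_path pq -xq.
Qed.

Lemma cluster_edge w x s : w (x, s) -> cluster w x <-> cluster w (x * val s).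
Proof.
by move=> ws; split=> /cluster_adj; apply; apply/open_adjP; exists s;
  [left|right].
Qed.

(** An open edge can be traversed both ways, hence the equivalence in the hypothesis. Later
    arguments use this closure property in place of explicit paths. *)
Lemma cluster_ind w (Q : G -> Prop) : Q 1 ->
  (forall x s, w (x, s) -> Q x <-> Q (x * val s)) ->
  forall x, cluster w x -> Q x.
Proof.
move=> Q1 QS x [q + ->]; elim/last_ind: q => [//|q y IHq].
rewrite rcons_path last_rcons => /andP[/IHq Qq /open_adjP[s [[ws ->]|[ws e]]]].
  by apply/(QS _ _ ws).
by apply/(QS _ _ ws); rewrite -e.
Qed.

Lemma cluster_sub w w' : (forall x s, w (x, s) -> w' (x, s)) ->
  cluster w `<=` cluster w'.
Proof.
move=> ww'; apply: cluster_ind; first exact: cluster1.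
by move=> x s /ww'; exact: cluster_edge.
Qed.

(** Connection to the identity by at most [n] open edges. Each level inspects only the finitely many
    edges at [x], so measurability follows by induction on [n]. *)
Fixpoint reach w (n : nat) x : bool :=
  if n is n'.+1 then
    reach w n' x || [exists s, w (x, s) && reach w n' (x * val s) ||
                     w (x * (val s)^-1, s) && reach w n' (x * (val s)^-1)]
  else x == 1.

Lemma clusterE w x : cluster w x <-> exists n, reach w n x.
Proof.
split.
  move: x; apply: cluster_ind; first by exists 0%N; exact: eqxx.
  move=> x s ws; split=> -[n rn]; exists n.+1 => /=; apply/orP; right;
    apply/existsP; exists s; last by rewrite ws rn.
  by rewrite mulgK ws rn orbT.
move=> [n]; elim: n x => [|n IHn] x /=; first by move=> /eqP ->; exact: cluster1.
case/orP=> [/IHn//|/existsP[s /orP[]/andP[ws /IHn]]].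
  by move=> h; apply/(cluster_edge ws).
by move/(cluster_edge ws); rewrite mulgVK.
Qed.

Lemma measurable_reach n x :
  measurable ([set w | reach w n x] : set configuration).
Proof.
elim: n x => [|n IHn] x /=.
  case: (x == 1); last by rewrite set_false.
  by rewrite set_true; exact: measurableT.
have -> : [set w | reach w n.+1 x] = [set w | reach w n x] `|`
    [set w : configuration | exists2 s, s \in enum (S : finType) &
      ([set w | w (x, s) = true] `&` [set w | reach w n (x * val s)] `|`
       [set w | w (x * (val s)^-1, s) = true] `&`
       [set w | reach w n (x * (val s)^-1)]) w].
  apply/seteqP; split=> w /=.
    case/orP=> [|/existsP[s /orP[]/andP[? ?]]]; [by left|right|right];
      (exists s; first by rewrite mem_enum); by [left|right].
  move=> [->//|[s _ h]]; apply/orP; right; apply/existsP; exists s.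
  by case: h => -[-> ->]; rewrite ?orbT.
apply: measurableU => //; apply: measurable_bigcup_seq => s.
apply: measurableU; apply: measurableI => //; exact: measurable_coord.
Qed.

Lemma measurable_cluster x :
  measurable ([set w | cluster w x] : set configuration).
Proof.
have -> : [set w | cluster w x] =
    \bigcup_n ([set w | reach w n x] : set configuration).
  by apply/seteqP; split=> w /=; rewrite clusterE => -[n]; exists n.
by apply: bigcup_measurable => n _; exact: measurable_reach.
Qed.

Lemma countable_group : generates S -> countable [set: G].
Proof.
move=> genS; have /countable_injP[f finj] := countable_cayley_edge genS.
(* Without generators there are no edges, but then the group is trivial; otherwise [x] is sent to
   the edge [(x, s)] for a fixed generator [s]. *)
apply/countable_injP; have [S0|[s sS]] := fset_0Vmem S.
  exists (fun=> 0%N) => x y _ _ _.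
  suff H z : z \in pred1 (1 : G) by rewrite (eqP (H x)) (eqP (H y)).
  apply: genS; last by move=> s; rewrite S0.
  split; first exact: eqxx.
  by move=> u v /eqP -> /eqP ->; rewrite divg1; exact: eqxx.
exists (fun x => f (x, [` sS]%fset)) => x y _ _ /finj.
by rewrite !inE => /(_ I I) [].
Qed.

End Clusters.

(** * The mean cluster size as a sum of connection probabilities *)

Section Counting.
Local Open Scope ereal_scope.

Lemma counting_esum (T : choiceType) (R : realType) (A : set T) :
  counting A = \esum_(x in A) (1 : \bar R).
Proof.
have cardE (B : {fset T}) :
    \sum_(x <- B) (1 : \bar R) = (#|` B|)%:R%:E.
  by rewrite -(big_map (fun=> 1%R) xpredT EFin) sumEFin big_map big_const_seq
    count_predT iter_addr_0.
rewrite /counting; case: asboolP => [finA|infA].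
  by rewrite esum_fset// fsbig_finite//= cardE.
apply/esym/eqyP => r r0; 
have [B BA Bn] := infinite_set_fset (Num.truncn r).+1 infA.
apply: esum_ge; exists [set` B]; first by split=> //; exact: finite_fset.
rewrite fsbig_finite//= set_fsetK cardE lee_fin.
apply: ltW; apply: lt_le_trans (truncnS_gt _) _; by rewrite ler_nat.
Qed.

Variables (G : groupType) (S : {fset G}) (R : realType).
Hypothesis genS : generates S.
Variable P : probability (configuration (cayley_edge S)) R.

(** An enumeration of the group turns cardinality into a series of indicators, which can be
    integrated term by term. *)
Lemma counting_nneseries : exists2 f : G -> nat, injective f &
  forall A, counting A = \sum_(k <oo) (\1_(f @` A) k)%:E :> \bar R.
Proof.
have /countable_injP[f finj] := countable_group genS.
have {}finj : injective f by move=> x y; apply: finj; rewrite inE.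
exists f => // A; rewrite counting_esum -(esum_image A f (fun=> 1)); last first.
  by move=> x y _ _; exact: finj.
rewrite esum_mkcond nneseries_esumT//.
by apply: eq_esum => k _; rewrite indicE; case: ifP.
Qed.

Lemma measurable_image_cluster (f : G -> nat) k : injective f ->
  measurable ([set w | (f @` cluster w) k] : set (configuration (cayley_edge S))).
Proof.
move=> finj; have [[x _ <-]|fk] := pselect (range f k).
  rewrite (_ : [set w | _] = [set w | cluster w x]).
    exact: measurable_cluster.
  apply/seteqP; split=> w /=; last by exists x.
  by move=> [y wy /finj <-].
rewrite (_ : [set w | _] = set0)//.
by apply/seteqP; split=> w //= [y _ yk]; apply: fk; exists y.
Qed.

Lemma measurable_counting_cluster :
  measurable_fun setT (fun w : configuration (cayley_edge S) =>
    counting (cluster w) : \bar R).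
Proof.
have [f finj cE] := counting_nneseries.
under eq_fun do rewrite cE.
apply: ge0_emeasurable_sum => [k w _ _|k _]; first by rewrite lee_fin.
apply/measurable_EFinP.
rewrite (_ : (fun w => _) = \1_[set w | (f @` cluster w) k]).
  by apply: measurable_indic; exact: measurable_image_cluster.
apply/funext => w; rewrite !indicE; congr ((nat_of_bool _)%:R).
Qed.

Lemma integral_counting_cluster :
  \int[P]_w counting (cluster w) =
  \esum_(x in [set: G]) P [set w | cluster w x].
Proof.
have [f finj cE] := counting_nneseries.
under eq_integral do rewrite cE.
have indE k : (fun w => (\1_(f @` cluster w) k)%:E : \bar R) =
    EFin \o \1_([set w | (f @` cluster w) k] :
      set (configuration (cayley_edge S))).
  apply/funext => w /=; rewrite !indicE; congr (((nat_of_bool _)%:R)%:E).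
rewrite integral_nneseries//; last first.
  move=> k; rewrite indE; apply/measurable_EFinP.
  by apply: measurable_indic; exact: measurable_image_cluster.
under eq_eseriesr => k _.
  rewrite indE integral_indic//; last exact: measurable_image_cluster.
  rewrite setIT; over.
rewrite nneseries_esumT//.
transitivity (\esum_(k in range f) P [set w | (f @` cluster w) k]).
  rewrite [RHS]esum_mkcond; apply: eq_esum => k _.
  case: ifPn => //; rewrite notin_setE => fk.
  rewrite (_ : [set w | _] = set0) ?measure0//.
  by apply/seteqP; split=> w //= [y _ yk]; apply: fk; exists y.
rewrite esum_image; last by move=> x y _ _; exact: finj.
apply: eq_esum => x _; congr (P _); apply/seteqP; split=> w /=; last by exists x.
by move=> [y wy /finj <-].
Qed.

Lemma measurable_infinite_cluster :
  measurable ([set w | infinite_set (cluster w)] :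
    set (configuration (cayley_edge S))).
Proof.
have -> : [set w | infinite_set (cluster w)] =
    (fun w : configuration (cayley_edge S) => counting (cluster w) : \bar R)
      @^-1` [set +oo].
  by apply/seteqP; split=> w /=; rewrite /counting; case: asboolP.
rewrite -[X in measurable X]setTI; apply: measurable_counting_cluster => //.
Qed.

(** The cluster size is then integrable, hence finite almost everywhere. *)
Lemma finite_mean_infinite_cluster :
  \esum_(x in [set: G]) P [set w | cluster w x] < +oo ->
  P [set w | infinite_set (cluster w)] = 0.
Proof.
move=> foo; have : P.-integrable setT (fun w => counting (cluster w)).
  apply/integrableP; split; first exact: measurable_counting_cluster.
  rewrite [ltLHS](_ : _ = \int[P]_w counting (cluster w)).
    by rewrite integral_counting_cluster.
  by apply: eq_integral => w _; rewrite gee0_abs// counting_esum esum_ge0.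
move=> /integrable_ae-/(_ measurableT) h.
apply: measure_negligible; first exact: measurable_infinite_cluster.
apply: negligibleS h => w /= infw h.
by have := h I; rewrite /counting asboolF.
Qed.

End Counting.

(** * Finite partial sums of nonnegative families *)

Lemma ler_sum_subset (R : numDomainType) (I : eqType) (r1 r2 : seq I)
    (F : I -> R) :
  uniq r1 -> {subset r1 <= r2} -> (forall i, 0 <= F i) ->
  \sum_(i <- r1) F i <= \sum_(i <- r2) F i.
Proof.
move=> + + F0; elim: r1 r2 => [|i r1 IHr] r2.
  by rewrite big_nil => _ _; exact: sumr_ge0.
rewrite cons_uniq => /andP[ir1 ur1] r12.
have ir2 : i \in r2 by apply: r12; rewrite inE eqxx.
rewrite (perm_big _ (perm_to_rem ir2)) !big_cons lerD2l; apply: IHr => // j jr1.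
apply: rem_mem; last by apply: r12; rewrite inE jr1 orbT.
by apply: contraNneq ir1 => <-.
Qed.

Section NonnegativeSums.
Variables (R : realType) (T : choiceType) (a : T -> R).
Hypothesis a_ge0 : forall x, 0 <= a x.

Lemma esum_le_fsets C : (forall Z : {fset T}, \sum_(z <- Z) a z <= C) ->
  (\esum_(x in [set: T]) (a x)%:E <= C%:E)%E.
Proof.
move=> aC; apply: ge_ereal_sup => _ [X [finX _] <-].
by rewrite fsbig_finite//= sumEFin lee_fin.
Qed.

Lemma fset_le_esum (Z : {fset T}) :
  ((\sum_(z <- Z) a z)%:E <= \esum_(x in [set: T]) (a x)%:E)%E.
Proof.
apply: esum_ge; exists [set` Z]; first by split=> //; exact: finite_fset.
by rewrite fsbig_finite//= set_fsetK sumEFin.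
Qed.

(** A finite [F] whose partial sum is within [d] of the total works: a disjoint [Z] has to fit into
    the remainder. *)
Lemma esum_tail d : (\esum_(x in [set: T]) (a x)%:E < +oo)%E -> 0 < d ->
  exists F : {fset T}, forall Z : {fset T},
    (forall z, z \in Z -> z \notin F) -> \sum_(z <- Z) a z < d.
Proof.
move=> afin d0.
have e0 : (0 <= \esum_(x in [set: T]) (a x)%:E)%E.
  by apply: esum_ge0 => x _; rewrite lee_fin.
have : ((fine (\esum_(x in [set: T]) (a x)%:E) - d)%:E <
        \esum_(x in [set: T]) (a x)%:E)%E.
  by rewrite -[ltRHS]fineK ?ge0_fin_numE// lte_fin ltrBlDr ltrDl.
move=> /ereal_sup_gt[_ [X [finX _] <-]]; rewrite fsbig_finite//= sumEFin.
move=> Xd; exists (fset_set X) => Z ZX.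
have := fset_le_esum (fset_set X `|` Z)%fset.
rewrite -[leRHS]fineK ?ge0_fin_numE// lee_fin.
rewrite (perm_big (fset_set X ++ Z))/= ?big_cat/=; last first.
  apply: uniq_perm; rewrite ?fset_uniq ?cat_uniq ?fset_uniq/= ?andbT//.
    by apply/hasPn => z /ZX.
  by move=> z; rewrite inE mem_cat.
move: Xd; rewrite lte_fin; lra.
Qed.

End NonnegativeSums.

(** * Varying the parameter, and translation invariance *)

Section CayleyPercolation.
Variables (R : realType) (G : groupType) (S : {fset G}).
Hypothesis genS : generates S.
Local Notation edge := (cayley_edge S).
Local Notation configuration := (configuration edge).
Implicit Types (w : configuration) (x y z : G) (s : S) (p q : R).
Local Notation P p := (percolation S p).

Let sprinkle_itv p q : p <= q -> q <= 1 -> p < 1 ->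
  0 <= (q - p) / (1 - p) <= 1.
Proof.
move=> pq q1 p1; apply/andP; split; first by apply: divr_ge0; lra.
by rewrite ler_pdivrMr ?subr_gt0//; lra.
Qed.

(** The density [eps = (q - p) / (1 - p)] solves [1 - q = (1 - p) * (1 - eps)]: sprinkling with it
    raises the parameter from [p] to [q]. *)
Lemma percolation_sprinkle p q (A : set configuration) :
  0 <= p -> p <= q -> q <= 1 -> p < 1 -> measurable A ->
  P q A = (P p \x P ((q - p) / (1 - p)))%E (@sprinkle _ @^-1` A).
Proof.
move=> p0 pq q1 p1 mA; apply: (bernoulli_sprinkle (p := p) (q := q)
    (eps := (q - p) / (1 - p))) => //.
- by apply: percolationP => //; rewrite p0 ltW.
- by apply: percolationP => //; exact: sprinkle_itv.
- by apply: percolationP => //; rewrite (le_trans p0 pq).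
- by field; lra.
Qed.

Lemma measurable_preimage_sprinkle (A : set configuration) :
  measurable A -> measurable (@sprinkle edge @^-1` A).
Proof.
by move=> mA; rewrite -[X in measurable X]setTI; exact: measurable_sprinkle.
Qed.

Lemma percolation_mono p q (A : set configuration) :
  0 <= p -> p <= q -> q <= 1 -> measurable A ->
  (forall w w', (forall e, w e -> w' e) -> A w -> A w') ->
  Pr (P p) A <= Pr (P q) A.
Proof.
move=> p0 pq q1 mA incA; have [p1|p1] := ltP p 1; last first.
  by have -> : p = q by apply/eqP; rewrite eq_le pq (le_trans q1).
rewrite -lee_fin -!PrE// (percolation_sprinkle p0 pq q1 p1 mA).
apply: le_trans (_ : (P p \x P ((q - p) / (1 - p)))%E (A `*` setT) <= _)%E.
  rewrite product_measure1E//.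
  by rewrite [X in (_ * X)%E]probability_setT mule1.
apply: le_measure; rewrite ?inE.
- exact: measurableX.
- exact: measurable_preimage_sprinkle.
- by move=> [w1 w2] /= [Aw _]; apply: incA Aw => e; rewrite /sprinkle /= => ->.
Qed.

Lemma Pr_edge p (e : edge) : 0 <= p <= 1 ->
  Pr (P p) [set w | w e = true] = p.
Proof.
move=> p01; 
have := is_bernoulli_constant_on (percolationP genS p01) [fset e]%fset true.
rewrite cardfs1 expr1 /= /Pr => h.
rewrite (_ : [set w | _] = constant_on [fset e]%fset true); first by rewrite h.
apply/seteqP; split=> w /=; first by move=> we e'; rewrite inE => /eqP ->.
by apply; rewrite inE.
Qed.

(** If no edge of [D] is sprinkled, the event does not notice the change; a union bound over [D]
    controls the opposite case. *)
Lemma percolation_continuity p q (D : {fset edge}) (A : set configuration) :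
  0 <= p -> p <= q -> q <= 1 -> p < 1 -> measurable A ->
  (forall w w', (forall e, e \in D -> w e = w' e) -> A w -> A w') ->
  Pr (P q) A <= Pr (P p) A + #|` D|%:R * ((q - p) / (1 - p)).
Proof.
move=> p0 pq q1 p1 mA hA; set eps := (q - p) / (1 - p).
have eps01 : 0 <= eps <= 1 by exact: sprinkle_itv.
pose B : set configuration :=
  [set w | exists2 e, e \in enum_fset D & [set w | w e = true] w].
have mB : measurable B.
  by apply: measurable_bigcup_seq => e; exact: measurable_coord.
have PB : Pr (P eps) B <= #|` D|%:R * eps.
  apply: (le_trans (Pr_sub_sum (P eps) mB
    (fun e => measurable_coord e true) (fun w h => h))).
  under eq_bigr do rewrite Pr_edge//.
  by rewrite big_const_seq count_predT iter_addr_0 mulr_natl.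
apply: le_trans (_ : Pr (P p) A + Pr (P eps) B <= _); last by rewrite lerD2l.
rewrite -lee_fin EFinD -!PrE// (percolation_sprinkle p0 pq q1 p1 mA) -/eps.
have AT : (P p \x P eps)%E (A `*` setT) = P p A.
  rewrite product_measure1E//.
  by rewrite [X in (_ * X)%E]probability_setT mule1.
have TB : (P p \x P eps)%E (setT `*` B) = P eps B.
  rewrite product_measure1E//.
  by rewrite [X in (X * _)%E]probability_setT mul1e.
rewrite -AT -TB.
apply: le_trans (measureU2 (P p \x P eps)%E (measurableX mA measurableT)
  (measurableX measurableT mB)).
apply: le_measure; rewrite ?inE.
- exact: measurable_preimage_sprinkle.
- by apply: measurableU; exact: measurableX.
move=> [w1 w2] /= Aw; have [Bw|Bw] := pselect (B w2); first by right.
left; split=> //; apply: hA Aw => e eD; rewrite /sprinkle /=.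
by case w2e: (w2 e); rewrite ?orbF//; exfalso; apply: Bw; exists e.
Qed.

Local Open Scope group_scope.

(* [(s, true)] and [(s, false)] stand for a step along [s] and along its
   inverse. *)
Definition neighbor x (t : S * bool) : G :=
  if t.2 then x * val t.1 else x * (val t.1)^-1.
Definition step_edge x (t : S * bool) : edge :=
  (if t.2 then x else x * (val t.1)^-1, t.1).

Lemma neighborM y x t : neighbor (y * x) t = y * neighbor x t.
Proof. by rewrite /neighbor; case: t.2; rewrite mulgA. Qed.

(** The edge of the step [t] has endpoints [x] and [neighbor x t] in one order or the other;
    requiring [Q] of both hides the orientation. *)
Lemma step_edgeP x t (Q : G -> Prop) :
  (Q (step_edge x t).1 /\ Q ((step_edge x t).1 * val (step_edge x t).2)) <->
  (Q x /\ Q (neighbor x t)).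
Proof.
rewrite /step_edge /neighbor; case: t => s [] //=; rewrite mulgVK.
by split=> -[].
Qed.

Lemma cluster_step w x t : w (step_edge x t) -> cluster w x ->
  cluster w (neighbor x t).
Proof.
case: t => s []; rewrite /step_edge /neighbor /= => ws.
  by move=> h; apply/(cluster_edge ws).
by move=> h; apply/(cluster_edge ws); rewrite mulgVK.
Qed.

Lemma cluster_step_ind w (Q : G -> Prop) : Q 1 ->
  (forall x t, w (step_edge x t) -> Q x -> Q (neighbor x t)) ->
  forall x, cluster w x -> Q x.
Proof.
move=> Q1 QS; apply: cluster_ind => // x s ws; split=> Qx.
  by have := QS x (s, true); rewrite /neighbor /=; apply.
have := QS (x * val s) (s, false); rewrite /neighbor/= mulgK; apply=> //.
by rewrite /step_edge /= mulgK.
Qed.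

Definition translate y (e : edge) : edge := (y * e.1, e.2).

Lemma translate_step y x t : translate y (step_edge x t) = step_edge (y * x) t.
Proof. by rewrite /translate /step_edge /=; case: t.2; rewrite ?mulgA. Qed.

Lemma translate_inj y : injective (translate y).
Proof. by move=> [x s] [x' s'] [/mulgI -> ->]. Qed.

Definition keep_on (D : set edge) w : configuration := fun e => w e && `[< D e >].

Lemma keep_onP D w e : reflect (w e /\ D e) (keep_on D w e).
Proof. by apply: (iffP andP) => -[we /asboolP]. Qed.

Lemma measurable_keep_on D : measurable_fun setT (keep_on D).
Proof.
apply: measurable_fun_configuration => e b; rewrite /keep_on.
case: asboolP => De; last first.
  have [fb|fb] := pselect (false = b).
    rewrite (_ : [set w | _] = setT)//.
    by apply/seteqP; split=> w //=; rewrite andbF.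
  rewrite (_ : [set w | _] = set0)//.
  by apply/seteqP; split=> w //=; rewrite andbF.
rewrite (_ : [set w | _] = [set w : configuration | w e = b]).
  exact: measurable_coord.
by apply/seteqP; split=> w /=; rewrite andbT.
Qed.

Lemma measurable_preimage (f : configuration -> configuration)
    (A : set configuration) :
  measurable_fun setT f -> measurable A -> measurable [set w | A (f w)].
Proof. by move=> mf mA; rewrite -[X in measurable X]setTI; exact: mf. Qed.

Definition conn p x : R := Pr (P p) [set w | cluster w x].

Lemma conn_ge0 p x : (0 <= conn p x)%R. Proof. exact: Pr_ge0. Qed.
Lemma conn_le1 p x : (conn p x <= 1)%R.
Proof. by apply: Pr_le1; exact: measurable_cluster. Qed.

Lemma conn_translate p y x : (0 <= p <= 1)%R ->
  Pr (P p) [set w | cluster (relabel (translate y) w) x] = conn p x.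
Proof.
move=> p01; rewrite /conn /Pr; congr fine.
have HP := percolationP genS p01.
exact: (bernoulli_relabel (@translate_inj y) HP HP (measurable_cluster x)).
Qed.

Lemma conn_mono p q x : (0 <= p)%R -> (p <= q)%R -> (q <= 1)%R ->
  (conn p x <= conn q x)%R.
Proof.
move=> p0 pq q1; apply: percolation_mono => //; first exact: measurable_cluster.
by move=> w w' ww'; apply: cluster_sub => *; exact: ww'.
Qed.

End CayleyPercolation.

(** * A finite mean is an open condition *)

Section SimonLieb.
Variables (R : realType) (G : groupType) (S : {fset G}).
Hypothesis genS : generates S.
Local Notation edge := (cayley_edge S).
Local Notation configuration := (configuration edge).
Implicit Types (w : configuration) (x y z : G) (s : S) (t : S * bool) (p q : R).
Local Notation P p := (percolation S p).
Variable L : {fset G}.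
Hypothesis L1 : 1%g \in L.

Definition touches (K : set G) (e : edge) : Prop :=
  K e.1 \/ K (e.1 * val e.2)%g.

Definition inner w : set G :=
  cluster (keep_on (fun e => e.1 \in L /\ (e.1 * val e.2)%g \in L) w).

Lemma inner_sub w x : inner w x -> x \in L.
Proof.
move: x; apply: cluster_step_ind => // x t /keep_onP[_].
by move=> /(step_edgeP x t (fun x => x \in L))[].
Qed.

Lemma inner_step w x t : w (step_edge x t) -> inner w x ->
  neighbor x t \in L -> inner w (neighbor x t).
Proof.
move=> we wx yL; apply: cluster_step (wx); apply/keep_onP; split=> //.
by apply/(step_edgeP x t (fun x => x \in L)); split=> //; exact: inner_sub wx.
Qed.

Definition outer (K : set G) w : configuration :=
  keep_on (fun e => ~ touches K e) w.

(** The pair [(x, t)] is the last step of an open path out of the inner cluster; afterwards the path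
    uses no edge touching that cluster. Such a step leaves [L], since otherwise its endpoint would
    be inner as well. *)
Lemma cluster_exit w z : cluster w z -> inner w z \/
  exists x t, [/\ inner w x, neighbor x t \notin L &
    cluster (relabel (translate (neighbor x t)) (outer (inner w) w))
      ((neighbor x t)^-1 * z)%g].
Proof.
move: z; apply: cluster_step_ind; first by left; exact: cluster1.
move=> z t we Qz; have [inn|ninn] := pselect (inner w (neighbor z t)).
  by left.
right; have [inz|ninz] := pselect (inner w z).
  exists z, t; split=> //; last by rewrite mulVg; exact: cluster1.
  by apply/negP => yL; apply: ninn; exact: inner_step.
case: Qz => // -[x [t' [xin yL xz]]]; exists x, t'; split=> //.
rewrite -neighborM; apply: cluster_step xz.
rewrite /relabel translate_step mulVKg; apply/keep_onP; split=> //.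
have : ~ inner w z /\ ~ inner w (neighbor z t) by [].
by move=> /(step_edgeP z t (fun x => ~ inner w x))[h1 h2] [].
Qed.

Definition inner_is (K : {fset G}) : set configuration :=
  [set w | forall x, x \in L -> inner w x <-> x \in K].

Lemma measurable_inner x : measurable [set w | inner w x].
Proof.
exact: measurable_preimage (measurable_keep_on _) (measurable_cluster x).
Qed.

Lemma measurable_inner_is K : measurable (inner_is K).
Proof.
rewrite (_ : inner_is K = \bigcap_(x in [set` L])
    if x \in K then [set w | inner w x] else ~` [set w | inner w x]).
  apply: fin_bigcap_measurable; first exact: finite_fset.
  move=> x _; case: ifP => _; last apply: measurableC; exact: measurable_inner.
apply/seteqP; split=> w /= h x xL; have := h x xL; case: ifP => //= xK.
- by move=> ->.
- by move=> [+ _] => /[apply].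
Qed.

(** Exploring the inner cluster from the identity until it is found to be [K] inspects only edges
    with an endpoint in [K]. The event is therefore independent of everything off these edges. *)
Lemma inner_is_local (K : {fset G}) w w' : {subset K <= L} ->
  (forall e, touches [set` K] e -> w e = w' e) -> inner_is K w -> inner_is K w'.
Proof.
move=> KL ww' wK.
have inK x : inner w x -> x \in K.
  by move=> wx; apply/wK => //; exact: inner_sub wx.
have Kin x : x \in K -> inner w x by move=> xK; apply/wK => //; exact: KL.
have same x t : x \in K -> w (step_edge x t) = w' (step_edge x t).
  move=> xK; apply: ww'; apply: contrapT => h.
  have [] // : (~ x \in K) /\ ~ (neighbor x t \in K).
  apply/(step_edgeP x t (fun x => ~ x \in K)).
  by split=> ?; apply: h; [left|right].
move=> x xL; split.
  move: x {xL}; apply: cluster_step_ind; first by apply: inK; exact: cluster1.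
  move=> x t /keep_onP[we /(step_edgeP x t (fun x => x \in L))[xL yL]] xK.
  apply: inK; apply: inner_step => //; last exact: Kin.
  by rewrite same.
move=> /Kin wx.
suff [] : inner w' x /\ x \in K by [].
move: x {xL} wx; apply: cluster_step_ind.
  by split; [exact: cluster1|apply: inK; exact: cluster1].
move=> x t /keep_onP[we /(step_edgeP x t (fun x => x \in L))[xL yL]] [wx xK].
split; first by apply: inner_step => //; rewrite -same.
by apply: inK; apply: inner_step => //; exact: Kin.
Qed.

Definition exits x t : bool := neighbor x t \notin L.

(** Given that the inner cluster is [K], the rest of the path after the last exit lives on edges not
    touching [K], so it is independent of that event; translated to the identity, it has probability
    at most [conn]. Then the bounds are summed over [K]. *)
Lemma conn_exit p z : 0 <= p <= 1 -> z \notin L -> conn S p z <=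
  \sum_(x <- L) \sum_(t : S * bool | exits x t)
    Pr (P p) [set w | inner w x] * conn S p ((neighbor x t)^-1 * z)%g.
Proof.
move=> p01 zL.
pose A y (K : {fset G}) := [set w | cluster (relabel (translate y)
  (outer [set` K] w)) (y^-1 * z)%g].
have mA y K : measurable (A y K).
  have mf := measurableT_comp (measurable_relabel (@translate _ S y))
    (measurable_keep_on (fun e => ~ touches [set` K] e)).
  exact: (measurable_preimage mf (measurable_cluster _)).
pose F (i : {fset G} * G * (S * bool)) : set configuration :=
  if (i.1.2 \in i.1.1) && exits i.1.2 i.2
  then inner_is i.1.1 `&` A (neighbor i.1.2 i.2) i.1.1 else set0.
have mF i : measurable (F i).
  rewrite /F; case: ifP => // _; apply: measurableI => //.
  exact: measurable_inner_is.
pose r := [seq (Kx, t) | Kx <- [seq (K, x) | K <- fpowerset L, x <- L],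
                         t <- index_enum (S * bool)%type].
have := Pr_sub_sum (P p) (r := r) (measurable_cluster z) mF.
rewrite {1}/r big_allpairs big_allpairs => h; apply: (le_trans (h _)) => {h}.
  move=> w wz; have [/inner_sub|] := cluster_exit wz; first by rewrite (negPf zL).
  move=> [x [t [xin yL yz]]]; pose K := [fset x in L | `[< inner w x >]]%fset.
  have KE : [set` K] = inner w.
    apply/seteqP; split=> u /=; rewrite !inE; first by case/andP=> _ /asboolP.
    by move=> wu; rewrite (inner_sub wu); exact/asboolP.
  have xK : x \in K by rewrite !inE (inner_sub xin); exact/asboolP.
  exists (K, x, t); last first.
    rewrite /F /= xK /exits yL; split; last by rewrite /A KE.
    by move=> u uL; rewrite !inE uL /=; split=> /asboolP.
  apply/allpairsP; exists ((K, x), t); split; rewrite ?mem_index_enum//.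
  apply/allpairsP; exists (K, x); split=> //=; last exact: inner_sub xin.
  by rewrite fpowersetE; apply/fsubsetP => u; rewrite !inE => /andP[].
rewrite exchange_big big_seq [leRHS]big_seq; apply: ler_sum => x xL.
rewrite exchange_big [leRHS]big_mkcond; apply: ler_sum => t _.
case: ifPn => xt; last first.
  by rewrite big1// => K _; rewrite /F (negPf xt) andbF /Pr measure0.
have PF K : K \in fpowerset L -> Pr (P p) (F (K, x, t)) <=
    Pr (P p) (if x \in K then inner_is K else set0) *
    conn S p ((neighbor x t)^-1 * z)%g.
  rewrite fpowersetE => /fsubsetP KL; rewrite /F xt andbT /=.
  case: ifP => _; last by rewrite /Pr measure0 mul0r.
  rewrite -lee_fin -PrE; last first.
    by apply: measurableI => //; exact: measurable_inner_is.
  rewrite (bernoulli_independent (percolationP genS p01)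
    (D := touches [set` K]) (measurable_inner_is K) (mA _ K)); last 2 first.
  - by move=> w w'; exact: inner_is_local.
  - move=> w w' ww'; rewrite /A /=; congr (cluster (relabel _ _) _).
    apply/funext => e; rewrite /outer /keep_on; case: asboolP; rewrite ?andbF//.
    by move=> /ww' ->.
  rewrite PrE ?[X in (_ * X)%E]PrE//; last exact: measurable_inner_is.
  rewrite -EFinM lee_fin ler_wpM2l ?Pr_ge0//.
  rewrite -(conn_translate genS (neighbor x t) _ p01).
  apply: le_Pr => //.
    exact: (measurable_preimage (measurable_relabel _) (measurable_cluster _)).
  by move=> w; apply: cluster_sub => u s /keep_onP[].
rewrite big_seq; apply: (le_trans (ler_sum _ PF)); rewrite -big_seq -mulr_suml.
(* A configuration realises [inner_is K] for at most one subset [K] of [L], so the sum over those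
   containing [x] is at most the probability that [x] is inner. *)
rewrite ler_wpM2r ?conn_ge0//; apply: Pr_sum_disjoint.
- exact: measurable_inner.
- by move=> K; case: ifP => // _; exact: measurable_inner_is.
- exact: fset_uniq.
- move=> K; rewrite fpowersetE => /fsubsetP KL; case: ifP => [xK w /= wK|_ w []].
  by apply/(wK _ (KL _ xK)).
- move=> K K'; rewrite !fpowersetE => /fsubsetP KL /fsubsetP K'L w.
  case: ifP => [_|_ []]; case: ifP => [_|_ _ []] /= wK wK'; apply/fsetP => u.
  apply/idP/idP => uK.
    by apply/(wK' _ (KL _ uK)); apply/(wK _ (KL _ uK)).
  by apply/(wK _ (K'L _ uK)); apply/(wK' _ (K'L _ uK)).
Qed.

(** The mean number of steps leaving [L] from the inner cluster, counted whether or not their edges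
    are open. *)
Definition exit_mean p : R :=
  \sum_(x <- L) \sum_(t : S * bool | exits x t) Pr (P p) [set w | inner w x].

(** Points of [L] contribute at most its cardinality, and the others at most [phi] times a bound for
    translates of the set, which have the same size. Iterating from the trivial bound leaves the
    fixed point [B] and an error [phi ^+ k] that vanishes in the limit. *)
Lemma sum_conn_le p (Z : {fset G}) : 0 <= p <= 1 -> exit_mean p < 1 ->
  \sum_(z <- Z) conn S p z <= #|` L|%:R / (1 - exit_mean p).
Proof.
move=> p01 phi1; set phi := exit_mean p in phi1 *.
have phi0 : 0 <= phi.
  by apply: sumr_ge0 => x _; apply: sumr_ge0 => t _; exact: Pr_ge0.
set B := _ / _.
have BE : #|` L|%:R + phi * B = B by rewrite /B; field; lra.
have IH k (Y : {fset G}) :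
    \sum_(z <- Y) conn S p z <= B + phi ^+ k * #|` Y|%:R.
  elim: k Y => [|k IHk] Y.
    rewrite expr0 mul1r; apply: le_trans (_ : #|` Y|%:R <= _).
      rewrite -sum1_size natr_sum; apply: ler_sum => z _; exact: conn_le1.
    by rewrite lerDr divr_ge0// subr_ge0 ltW.
  rewrite (bigID (fun z => z \in L))/= -BE -addrA lerD//.
    apply: le_trans (_ : \sum_(z <- Y | z \in L) 1 <= _).
      by apply: ler_sum => z _; exact: conn_le1.
    rewrite -big_filter -sum1_size natr_sum; apply: ler_sum_subset => //.
      by rewrite filter_uniq.
    by move=> z; rewrite mem_filter => /andP[].
  apply: le_trans (_ : \sum_(z <- Y | z \notin L) \sum_(x <- L)
    \sum_(t : S * bool | exits x t) Pr (P p) [set w | inner w x] *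
      conn S p ((neighbor x t)^-1 * z)%g <= _).
    by apply: ler_sum => z; exact: conn_exit.
  rewrite exchange_big/= exprS -mulrA -mulrDr mulr_suml; apply: ler_sum => x _.
  rewrite exchange_big/= mulr_suml; apply: ler_sum => t xt.
  rewrite -mulr_sumr ler_wpM2l ?Pr_ge0//.
  pose Y' := [fset ((neighbor x t)^-1 * z)%g | z in Y]%fset.
  have inj : injective (fun z => (neighbor x t)^-1 * z)%g by exact: mulgI.
  have := IHk Y'; rewrite card_imfset//; apply: le_trans.
  rewrite [leRHS]big_imfset/=; last by move=> ? ? _ _; exact: inj.
  rewrite big_mkcond; apply: ler_sum => z _.
  by case: ifP => // _; exact: conn_ge0.
have cvgB : (fun k => B + phi ^+ k * #|` Z|%:R) @ \oo --> B + 0 * #|` Z|%:R.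
  apply: cvgD; first exact: cvg_cst.
  by apply: cvgMr_tmp; apply: cvg_expr; rewrite ger0_norm.
rewrite -[B in leRHS]addr0 -[0 in leRHS](mul0r #|` Z|%:R).
by apply: (cvgr_to_ge cvgB); apply: nearW => k; exact: IH.
Qed.

End SimonLieb.

(** * From a finite mean at one parameter to a larger parameter *)

Section Openness.
Variables (R : realType) (G : groupType) (S : {fset G}).
Hypothesis genS : generates S.
Implicit Types (p q : R).
Local Notation P p := (percolation S p).

Lemma mean_cluster_sizeE p :
  mean_cluster_size S p = \esum_(x in [set: G]) (conn S p x)%:E.
Proof.
rewrite /mean_cluster_size integral_counting_cluster//.
by apply: eq_esum => x _; rewrite PrE//; exact: measurable_cluster.
Qed.

Lemma theta_eq0 p : (mean_cluster_size S p < +oo)%E -> theta S p = 0%E.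
Proof.
rewrite /mean_cluster_size integral_counting_cluster//.
exact: finite_mean_infinite_cluster.
Qed.

Lemma theta_mono p q : 0 <= p -> p <= q -> q <= 1 -> (theta S p <= theta S q)%E.
Proof.
move=> p0 pq q1; have mI := measurable_infinite_cluster R genS.
rewrite /theta PrE// PrE// lee_fin; apply: percolation_mono => //.
move=> w w' ww' /= infw; apply: contra_not infw; apply: sub_finite_set.
by apply: cluster_sub => *; exact: ww'.
Qed.

(* A finite mean makes the expected number of exits from a large finite set
   smaller than 1; this is a condition on finitely many edges, hence it persists
   for slightly larger parameters, where it bounds the mean again. *)
Lemma finite_mean_open p : 0 <= p -> p < 1 ->
  (mean_cluster_size S p < +oo)%E ->
  exists q, [/\ p < q, q <= 1 & theta S q = 0%E].
Proof.
move=> p0 p1; rewrite mean_cluster_sizeE => foo.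
(* Chosen so that [M * (d + d) < 1]: one [d] bounds the tail of the connection probabilities, the
   other the effect of raising the parameter. *)
pose M := #|{: S * bool}|; pose d : R := (4 * M.+1%:R)^-1.
have d0 : 0 < d by rewrite invr_gt0 mulr_gt0.
have [F FP] := esum_tail (conn_ge0 S p) foo d0.
(* All neighbours of [F] lie in [L], so a step leaving [L] starts outside [F], where the connection
   probabilities have a small sum. *)
pose L := [fset z in 1%g :: enum_fset F ++
  [seq neighbor x t | x <- enum_fset F, t <- index_enum (S * bool)%type]]%fset.
have L1 : 1%g \in L by rewrite !inE eqxx.
have exF x (t : S * bool) : exits L x t -> x \notin F.
  apply: contraNN => xF; rewrite !inE; apply/orP; right.
  apply/orP; right; apply/allpairsP; exists (x, t).
  by rewrite mem_index_enum.
pose D : {fset cayley_edge S} :=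
  [fset e in [seq (x, s) | x <- enum_fset L, s <- index_enum S]]%fset.
(* Sprinkling with density [d / k] makes the continuity error, summed over [L], at most [d]; the
   successors keep [k] positive. *)
pose k : R := #|` L|.+1%:R * #|` D|.+1%:R.
have k1 : 1 <= k by rewrite /k -natrM ler1n.
have k0 : 0 < k by exact: lt_le_trans ltr01 k1.
pose eps := d / k.
have eps0 : 0 < eps by rewrite divr_gt0.
have M1 : 1 <= M.+1%:R :> R by rewrite ler1n.
have dM : 4 * (M.+1%:R * d) = 1 by rewrite mulrA mulfV// mulf_neq0.
have d1 : d <= 1 by move: dM M1 d0; nra.
have eps1 : eps <= 1 by rewrite /eps ler_pdivrMr// mul1r; exact: le_trans k1.
pose q := p + (1 - p) * eps.
have pq : p < q by rewrite /q ltrDl mulr_gt0// subr_gt0.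
have q1 : q <= 1 by rewrite /q; nra.
have qE : (q - p) / (1 - p) = eps by rewrite /q; field; lra.
exists q; split=> //; apply: theta_eq0; rewrite mean_cluster_sizeE.
have De0 : 0 <= #|` D|%:R * eps by apply: mulr_ge0 => //; exact: ltW.
have phi1 : exit_mean S L q < 1.
  apply: (@le_lt_trans _ _ (M%:R * (\sum_(x <- L | x \notin F) conn S p x +
     \sum_(x <- L) #|` D|%:R * eps))).
    rewrite mulrDr [in X in _ <= X + _]big_mkcond/= !mulr_sumr -big_split/=.
    apply: ler_sum => x _; case: ifPn => xF; last first.
      rewrite big1 ?mulr0 ?add0r; first exact: mulr_ge0.
      by move=> t /exF; rewrite (negPf xF).
    apply: le_trans (_ : \sum_(t : S * bool) (conn S p x + #|` D|%:R * eps) <= _);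
      last by rewrite sumr_const -mulrDr -[leLHS]mulr_natl.
    rewrite big_mkcond; apply: ler_sum => t _; case: ifP => _; last first.
      by rewrite addr_ge0 ?conn_ge0.
    rewrite -qE; apply: le_trans (percolation_continuity genS (D := D) p0
      (ltW pq) q1 p1 (measurable_inner L x) _) _.
      move=> w w' ww'; apply: cluster_sub => y s /keep_onP[we [/= yL ysL]].
      apply/keep_onP; split=> //; rewrite -ww'// inE.
      by apply/allpairsP; exists (y, s); rewrite mem_index_enum.
    rewrite lerD2r; apply: le_Pr.
    - exact: measurable_inner.
    - exact: measurable_cluster.
    - by move=> w; apply: cluster_sub => y s /keep_onP[].
  have h1 : \sum_(x <- L | x \notin F) conn S p x < d.
    have -> : \sum_(x <- L | x \notin F) conn S p x =
        \sum_(x <- [fset x in L | x \notin F]%fset) conn S p x.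
      by rewrite big_fset.
    by apply: FP => z; rewrite !inE => /andP[].
  have h2 : \sum_(x <- L) #|` D|%:R * eps <= d.
    rewrite big_const_seq count_predT iter_addr_0 -[leLHS]mulr_natl.
    rewrite [leLHS]mulrA /eps [leLHS]mulrCA.
    rewrite ger_pMr// ler_pdivrMr// mul1r /k.
    by rewrite ler_pM// ler_nat.
  have M0 : 0 <= M%:R :> R by [].
  have ME : M.+1%:R = M%:R + 1 :> R by rewrite -natr1.
  by rewrite ME in dM; move: dM h1 h2 d0 M0; set a := \sum_(x <- _ | _) _;
    set b := \sum_(x <- _) _; nra.
have q01 : 0 <= q <= 1 by rewrite q1 andbT ltW// (le_lt_trans p0).
apply: le_lt_trans (esum_le_fsets (fun Z => sum_conn_le genS L1 Z q01 phi1)) _.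
exact: ltry.
Qed.
End Openness.

(** * Sums over reduced words *)

Section Words.
Variables (R : realType) (n : nat) (G : 'I_n -> groupType).
Local Notation letter := {i : 'I_n & G i}.
Implicit Types (x y : letter) (w : seq letter) (i : option 'I_n) (j : 'I_n).
Variable L : seq letter.

(* Words over [L] whose first letter is not of type [i], where [None] means that
   all first letters are allowed. *)
Fixpoint words (k : nat) i : seq (seq letter) :=
  if k is k'.+1 then
    [seq x :: w | x <- [seq x <- L | Some (tag x) != i],
                  w <- words k' (Some (tag x))]
  else [:: [::]].

Definition avoids i w := if w is x :: _ then Some (tag x) != i else true.

Lemma mem_words w i : {subset w <= L} -> reduced w -> avoids i w ->
  w \in words (size w) i.
Proof.
elim: w i => [|x w IHw] i //= wL /andP[/= /andP[x1 aw] pw] xi.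
apply/allpairsPdep; exists x, w; split=> //.
  by rewrite mem_filter xi wL// inE eqxx.
apply: IHw; first by move=> y yw; apply: wL; rewrite inE yw orbT.
  by rewrite /reduced aw (path_sorted pw).
by case: w pw {aw wL} => //= y w /andP[+ _]; rewrite eq_sym.
Qed.

Lemma words_reduced k i w : all (fun x => tagged x != 1%g) L ->
  w \in words k i -> [/\ reduced w, avoids i w, size w = k & {subset w <= L}].
Proof.
move=> L1; elim: k i w => [|k IHk] i w /=; first by rewrite inE => /eqP ->.
case/allpairsPdep=> x [w' [xL /IHk[rw aw sw wL] ->]].
move: xL; rewrite mem_filter => /andP[xi xL]; split=> //=.
- case/andP: rw => a s; rewrite /reduced /= (allP L1 _ xL) a /=.
  by case: w' s aw {sw wL a} => //= y w' -> /=; rewrite andbT eq_sym.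
- by rewrite sw.
- by move=> y; rewrite inE => /predU1P[->//|/wL].
Qed.

Variable t : letter -> R.
Hypothesis t_ge0 : forall x, 0 <= t x.

Definition weight w : R := \prod_(x <- w) t x.

(** For [None] the sum is empty, so the state without a forbidden type has mass 0. *)
Definition mass i : R := \sum_(x <- L | Some (tag x) == i) t x.

Definition criterion : R := \sum_(j < n) mass (Some j) / (1 + mass (Some j)).

Lemma mass_ge0 i : 0 <= mass i. Proof. exact: sumr_ge0. Qed.

(** Summing [v] over the one-letter extensions allowed after type [i] gives [v i] shifted by
    [criterion - 1]. Thus [v] is harmonic at the threshold, and serves as the test function on both
    sides of it. *)
Let v i := (1 + mass i)^-1.

Let v_gt0 i : 0 < v i.
Proof. by rewrite invr_gt0 ltr_pwDl// mass_ge0. Qed.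

Let v_le1 i : v i <= 1.
Proof. by rewrite invf_le1 ?ltr_pwDl ?mass_ge0// lerDl mass_ge0. Qed.

Lemma weight_ge0 w : 0 <= weight w. Proof. exact: prodr_ge0. Qed.

Lemma sum_words k i (F : seq letter -> R) :
  \sum_(w <- words k.+1 i) F w =
  \sum_(x <- L | Some (tag x) != i)
     \sum_(w <- words k (Some (tag x))) F (x :: w).
Proof. by rewrite /= big_allpairs_dep big_filter. Qed.

(* [Some j] ranges over the types other than [i], and the remaining term of the
   criterion is [1 - v i]. *)
Let sum_letters i :
  \sum_(x <- L | Some (tag x) != i) t x * v (Some (tag x)) =
  criterion - 1 + v i.
Proof.
have massN : mass None = 0 by rewrite /mass big_pred0.
have E j : mass (Some j) * v (Some j) =
    \sum_(x <- L | tag x == j) t x * v (Some (tag x)).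
  rewrite /mass mulr_suml; apply: eq_big => [x|x /eqP[->]]//.
have -> : criterion - 1 + v i =
    \sum_(j < n | Some j != i) mass (Some j) * v (Some j).
  have vE : v i = 1 - mass i * v i.
    by rewrite /v; field; rewrite gt_eqF// ltr_pwDl// mass_ge0.
  rewrite vE /criterion; case: i {vE} => [j|].
    have -> : \sum_(k < n | Some k != Some j) mass (Some k) * v (Some k) =
      \sum_(k < n | k != j) mass (Some k) * v (Some k) by [].
    by rewrite (bigD1 j)//= -/(v _); ring.
  by rewrite massN mul0r subr0 subrK.
under [RHS]eq_bigr do rewrite E.
rewrite (exchange_big_dep (fun x => Some (tag x) != i))/=; last first.
  by move=> j x ji /eqP ->.
apply: eq_bigr => x xi; rewrite (big_pred1 (tag x))// => j.
by rewrite [tag x == j]eq_sym andb_idl// => /eqP ->.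
Qed.

(** The bound is the fixed point of splitting off the first letter: it equals 1 for the empty word
    plus the bounds for the remaining words, weighted by their first letters. *)
Lemma sum_weight_le m i : criterion < 1 ->
  \sum_(k < m) \sum_(w <- words k i) weight w <= v i / (1 - criterion).
Proof.
move=> s1; have s0 : 0 < 1 - criterion by rewrite subr_gt0.
elim: m i => [|m IHm] i; first by rewrite big_ord0 divr_ge0 ?ltW.
rewrite big_ord_recl/= big_seq1 [weight [::]]big_nil.
have -> : v i / (1 - criterion) = 1 + (criterion - 1 + v i) / (1 - criterion).
  by field; lra.
rewrite lerD2l -sum_letters mulr_suml.
under eq_bigr do rewrite sum_words.
rewrite exchange_big/=; apply: ler_sum => x _; rewrite -mulrA.
apply: le_trans (ler_wpM2l (t_ge0 x) (IHm _)).
rewrite mulr_sumr; apply: ler_sum => k _; rewrite mulr_sumr.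
by apply: ler_sum => w _; rewrite /weight big_cons.
Qed.

Lemma sum_weight_fset_le (Z : {fset free_product G}) : criterion < 1 ->
  (forall u, u \in Z -> {subset fp_word u <= L}) ->
  \sum_(u <- Z) weight (fp_word u) <= (1 - criterion)^-1.
Proof.
move=> s1 ZL; pose m := (\max_(u <- Z) size (fp_word u)).+1.
have -> : \sum_(u <- Z) weight (fp_word u) =
    \sum_(w <- [seq fp_word u | u <- Z]) weight w by rewrite big_map.
apply: le_trans (_ :
  \sum_(w <- flatten [seq words k None | k <- iota 0 m]) weight w <= _).
  apply: ler_sum_subset; last exact: weight_ge0.
    by rewrite map_inj_uniq ?fset_uniq//; exact: val_inj.
  move=> w /mapP[u uZ ->]; apply/flattenP; exists (words (size (fp_word u)) None).
    apply: (map_f (words^~ None)); rewrite mem_iota/= add0n ltnS.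
    exact: leq_bigmax_seq.
  by apply: mem_words; [exact: ZL|exact: fp_wordP|case: (fp_word u)].
rewrite big_flatten big_map -[iota 0 m]/(index_iota 0 m) big_mkord.
apply: le_trans (sum_weight_le m None s1) _.
by rewrite ler_piMl ?v_le1 ?invr_ge0 ?subr_ge0 ?ltW.
Qed.

(** * The second moment of the weighted number of words *)

Section SecondMoment.
Hypothesis L_uniq : uniq L.
Hypothesis s_gt1 : 1 < criterion.
Variable C : R.
Hypothesis C_ge0 : 0 <= C.

Let A i := criterion - 1 + v i.

Let A_gt0 i : 0 < A i.
Proof. by have := v_gt0 i; rewrite /A; have := s_gt1; lra. Qed.

Let sum_letters1 i :
  \sum_(x <- L | Some (tag x) != i) t x * (v (Some (tag x)) / A i) = 1.
Proof.
under eq_bigr do rewrite mulrA.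
by rewrite -mulr_suml sum_letters mulfV// gt_eqF// A_gt0.
Qed.

(** After type [i], choosing the letter [x] with probability [t x * v (Some (tag x)) / A i] defines
    a Markov chain; [bias] is the density of its law with respect to [weight], so the weighted
    number of words has mean 1. *)
Fixpoint bias i w : R :=
  if w is x :: w' then v (Some (tag x)) / A i * bias (Some (tag x)) w' else 1.

Lemma bias_ge0 i w : 0 <= bias i w.
Proof.
elim: w i => //= x w IHw i; rewrite mulr_ge0//.
by rewrite divr_ge0// ltW.
Qed.

Lemma sum_bias_weight k i :
  \sum_(w <- words k i) bias i w * weight w = 1.
Proof.
elim: k i => [|k IHk] i; first by rewrite big_seq1 /= mul1r /weight big_nil.
rewrite sum_words -[RHS](sum_letters1 i); apply: eq_bigr => x _ /=.
rewrite -[RHS]mulr1 -(IHk (Some (tag x))) mulr_sumr; apply: eq_bigr => w _.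
by rewrite /weight big_cons; ring.
Qed.

(* Upper bound for the probability that two words are both in the cluster. *)
Fixpoint pair_bound w w' : R :=
  match w, w' with
  | x :: w1, y :: w1' =>
    if x == y then t x * pair_bound w1 w1'
    else C * (weight w * weight w')
  | _, _ => 1
  end.

Definition second_moment_bound : R := 1 + C * criterion / (criterion - 1).

(** Pairs with the same first letter are handled by induction and give at most
    [second_moment_bound / A i]. Pairs with different first letters factorise, and as the biased
    weights sum to 1 they contribute at most [C]. *)
Lemma second_moment_le k i :
  \sum_(w <- words k i) \sum_(w' <- words k i)
    bias i w * bias i w' * pair_bound w w' <= second_moment_bound / v i.
Proof.
have s1 : 0 < criterion - 1 by rewrite subr_gt0.
have K1 : 1 <= second_moment_bound.
  rewrite lerDl; apply: divr_ge0; last exact: ltW.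
  by apply: mulr_ge0 => //; have := s_gt1; lra.
elim: k i => [|k IHk] i.
  rewrite !big_seq1 /= !mulr1 ler_pdivlMr// mul1r.
  exact: le_trans (v_le1 i) K1.
rewrite sum_words.
pose g x := v (Some (tag x)) / A i.
have g0 x : 0 <= g x by rewrite divr_ge0 ?ltW.
have gt1 : \sum_(x <- L | Some (tag x) != i) t x * g x = 1.
  exact: sum_letters1.
apply: le_trans (_ : \sum_(x <- L | Some (tag x) != i)
    (g x ^+ 2 * t x * (second_moment_bound / v (Some (tag x))) +
     C * (t x * g x)) <= _).
  rewrite big_seq_cond [leRHS]big_seq_cond; apply: ler_sum => x /andP[xL xi].
  pose j := Some (tag x).
  apply: le_trans (_ : \sum_(w <- words k j) (\sum_(y <- L | Some (tag y) != i)
      (if y == x then \sum_(w' <- words k (Some (tag y)))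
         g x ^+ 2 * t x * (bias j w * bias (Some (tag y)) w' * pair_bound w w')
       else 0) + \sum_(y <- L | Some (tag y) != i)
      \sum_(w' <- words k (Some (tag y))) C * (t x * g x) *
        (bias j w * weight w) * (t y * g y) *
        (bias (Some (tag y)) w' * weight w')) <= _).
    apply: ler_sum => w _; rewrite sum_words -big_split/=; apply: ler_sum => y _.
    rewrite [eq_op x y]eq_sym; case: (eqVneq y x) => [->|yx].
      rewrite -big_split/=; apply: ler_sum => w' _; rewrite -/(g x) -/j.
      rewrite [leLHS](_ : _ = g x ^+ 2 * t x *
        (bias j w * bias j w' * pair_bound w w')); last by ring.
      by rewrite lerDl !mulr_ge0 ?bias_ge0 ?weight_ge0 ?invr_ge0
        ?(ltW (A_gt0 _)) ?addr_ge0 ?mass_ge0.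
    rewrite add0r; apply: ler_sum => w' _; rewrite -/(g x) -/(g y) -/j.
    rewrite /weight !big_cons -!/(weight _) le_eqVlt; apply/orP; left; apply/eqP.
    ring.
  rewrite big_split/=; apply: lerD.
    apply: le_trans (ler_wpM2l _ (IHk j)); last first.
      by rewrite mulr_ge0// exprn_ge0.
    rewrite mulr_sumr; apply: ler_sum => w _.
    rewrite -big_mkcondr -big_filter.
    rewrite (_ : [seq y <- L | _] = [:: x]) ?big_seq1 ?mulr_sumr//.
    rewrite (eq_filter (a2 := pred1 x)); last first.
      by move=> y /=; rewrite andb_idl// => /eqP ->.
    by rewrite filter_pred1_uniq.
  rewrite -[leRHS]mulr1 -(sum_bias_weight k j) mulr_sumr; apply: ler_sum => w _.
  rewrite -[leRHS]mulr1 -gt1 mulr_sumr; apply: ler_sum => y _.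
  by rewrite -[leRHS]mulr1 -(sum_bias_weight k (Some (tag y))) mulr_sumr.
rewrite big_split/= -mulr_sumr gt1 mulr1.
(* Supercriticality enters here: [A i] exceeds [v i] by [criterion - 1], and [second_moment_bound]
   is large enough for the resulting gain to absorb [C]. *)
apply: le_trans (_ : second_moment_bound / A i + C <= _).
  rewrite lerD2r -[leRHS]mulr1 -gt1 mulr_sumr; apply: ler_sum => x _.
  rewrite le_eqVlt; apply/orP; left; apply/eqP; rewrite /g; field.
  by rewrite !gt_eqF.
have := v_le1 i; have := v_gt0 i; rewrite /A /second_moment_bound.
move: s1; set d := criterion - 1; have -> : criterion = 1 + d by rewrite /d; ring.
move: (v i) => u d0 u0 u1; clearbody d.
have -> : (1 + C * (1 + d) / d) / u =
    (1 + C * (1 + d) / d) / (d + u) + (d + C * (1 + d)) / (u * (d + u)).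
  by field; rewrite !lt0r_neq0//; exact: addr_gt0.
rewrite lerD2l ler_pdivlMr ?mulr_gt0 ?addr_gt0//.
by apply: le_trans (_ : C * (1 + d) <= _); [apply: ler_wpM2l => //; nra|lra].
Qed.

End SecondMoment.
End Words.

(** * Percolation on the free product *)

Section FreeProductWords.
Variables (n : nat) (G : 'I_n -> groupType).
Local Notation letter := {i : 'I_n & G i}.
Local Notation FP := (free_product G).
Implicit Types (x y : letter) (w : seq letter) (u : FP) (i : 'I_n).
Local Open Scope group_scope.

Definition letter_inj x : FP := fp_inj (tagged x).

Lemma fp_inj1 i : fp_inj (1 : G i) = 1.
Proof. by apply/val_inj; rewrite /= /fp_cons eqxx. Qed.

Lemma fp_inj_inj i : injective (@fp_inj _ G i).
Proof.
move=> g h /(congr1 (@fp_word _ _)) /(congr1 (@fp_head _ G i)).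
by rewrite /= !fp_head_cons.
Qed.

Lemma fp_word_injM i (g : G i) u : fp_word (fp_inj g * u) = fp_push g (fp_word u).
Proof. exact: (fp_mulw_cons g [::] (fp_wordP u)). Qed.

Definition word_prod w : FP := foldr (fun x u => letter_inj x * u) 1 w.

Lemma fp_push_reduced i (g : G i) w : reduced (Tagged G g :: w) ->
  fp_push g w = Tagged G g :: w.
Proof.
rewrite /reduced /= => /andP[/andP[g1 _] pw]; rewrite /fp_push.
case: w pw => [|x w] /=; first by rewrite mulg1 /fp_cons (negPf g1).
by rewrite eq_sym => /andP[/negPf -> _]; rewrite mulg1 /fp_cons (negPf g1).
Qed.

Lemma word_prodK w : reduced w -> fp_word (word_prod w) = w.
Proof.
elim: w => // -[i g] w IHw rw.
rewrite [LHS](fp_word_injM g (word_prod w)) IHw.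
  exact: fp_push_reduced.
by move: rw => /andP[/= /andP[_ aw] /path_sorted sw]; rewrite /reduced aw.
Qed.

Lemma fp_wordK u : word_prod (fp_word u) = u.
Proof. by apply/val_inj/word_prodK/fp_wordP. Qed.

Lemma word_prod_rcons w x : word_prod (rcons w x) = word_prod w * letter_inj x.
Proof. by elim: w => [|y w IHw] /=; rewrite ?mulg1 ?mul1g// IHw mulgA. Qed.

Definition ends i w := if w is x :: w' then tag (last x w') == i else false.

Lemma ends_rcons i w x : ends i (rcons w x) = (tag x == i).
Proof. by case: w => //= y w; rewrite last_rcons. Qed.

Lemma reduced_rcons w x :
  reduced (rcons w x) = [&& reduced w, tagged x != 1 & ~~ ends (tag x) w].
Proof.
rewrite /reduced all_rcons; case: w => [|y w] /=; first by rewrite !andbT.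
rewrite rcons_path andbACA -!andbA; do !bool_congr.
Qed.

Lemma reduced_cons_letter x w : tagged x != 1 -> reduced w ->
  (if w is y :: _ then tag x != tag y else true) -> reduced (x :: w).
Proof.
by rewrite /reduced /= => -> /andP[-> ]; case: w => //= y w -> ->.
Qed.

Lemma reduced_catl w w' : reduced (w ++ w') -> reduced w.
Proof. by rewrite /reduced all_cat => /andP[/andP[-> _] /cat_sorted2[->]]. Qed.

Lemma fp_word_mul_inj i (g : G i) u : ~~ ends i (fp_word u) -> g != 1 ->
  fp_word (u * fp_inj g) = rcons (fp_word u) (Tagged G g).
Proof.
move=> ui g1; rewrite -{1}[u]fp_wordK -(word_prod_rcons _ (Tagged G g)).
by rewrite word_prodK// reduced_rcons fp_wordP g1.
Qed.

(** The element [a] is the base point of the coset of factor [i] through [u]; when [u] does not end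
    in that factor, [g] is 1. *)
Lemma last_letter i u :
  exists a (g : G i), u = a * fp_inj g /\ ~~ ends i (fp_word a).
Proof.
case/lastP E: (fp_word u) => [|w x].
  by exists u, 1; rewrite fp_inj1 mulg1 E.
have := fp_wordP u; rewrite E reduced_rcons => /and3P[rw x1 xw].
have [ix|ix] := eqVneq (tag x) i.
  case: i / ix; exists (word_prod w), (tagged x); rewrite word_prodK//.
  by rewrite -[u]fp_wordK E word_prod_rcons.
by exists u, 1; rewrite fp_inj1 mulg1 E ends_rcons.
Qed.

Definition strip i w :=
  if w is x :: w' then if tag (last x w') == i then belast x w' else w else [::].

Lemma strip_id i w : ~~ ends i w -> strip i w = w.
Proof. by case: w => //= x w /negPf->. Qed.

Lemma strip_rcons w x : strip (tag x) (rcons w x) = w.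
Proof. by case: w => /= [|y w]; rewrite ?eqxx// last_rcons eqxx belast_rcons. Qed.

Lemma strip_mul_inj i (g : G i) u : ~~ ends i (fp_word u) ->
  strip i (fp_word (u * fp_inj g)) = fp_word u.
Proof.
move=> ui; have [->|g1] := eqVneq g 1; first by rewrite fp_inj1 mulg1 strip_id.
by rewrite fp_word_mul_inj//; exact: (strip_rcons _ (Tagged G g)).
Qed.

End FreeProductWords.

(** * Decomposition of the cluster along cosets, and independence *)

Section FreeProductPercolation.
Variables (n : nat) (G : 'I_n -> groupType) (S : forall i, {fset G i}).
Local Notation letter := {i : 'I_n & G i}.
Local Notation FP := (free_product G).
Local Notation T := (free_product_gens S).
Local Notation edge := (cayley_edge T).
Local Notation configuration := (configuration edge).
Implicit Types (x y : letter) (u a : FP) (i : 'I_n) (w : configuration)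
  (r : seq letter).
Local Open Scope group_scope.

Lemma free_product_gensP u : reflect
  (exists i, exists2 s, s \in S i & u = fp_inj s) (u \in T).
Proof.
apply: (iffP (@bigfcupP _ _ _ _ _ _)) =>
  [[i _ /imfsetP[s /= sS ->]]|[i [s sS ->]]].
  by exists i, s.
exists i; first by rewrite mem_enum.
by apply/imfsetP; exists s.
Qed.

Lemma lift_gen_subproof i (s : S i) : fp_inj (val s) \in T.
Proof. by apply/free_product_gensP; exists i, (val s) => //; exact: valP. Qed.

Definition lift_gen i (s : S i) : T := [` lift_gen_subproof s]%fset.

Lemma lift_genP (s : T) : exists i (s' : S i), s = lift_gen s'.
Proof.
have /free_product_gensP[i [s' s'S e]] := valP s.
by exists i, [` s'S]%fset; apply/val_inj.
Qed.

Lemma generates_free_product :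
  (forall i, generates (S i)) -> generates T.
Proof.
move=> genS H gH TH u; rewrite -[u]fp_wordK; elim: (fp_word u) => [|x r IHr] /=.
  by case: gH.
apply: (group_closedM gH) IHr => {r}; case: x => i g.
pose Hi : {pred G i} := fun g => fp_inj g \in H.
apply: (genS i Hi); last first.
  by move=> s sS; apply: TH; apply/free_product_gensP; exists i, s.
split; first by rewrite /Hi unfold_in fp_inj1; case: gH.
move=> g1 g2; rewrite /Hi !unfold_in fp_injM => h1 h2.
apply: (group_closedM gH) => //.
have <- : (fp_inj g2)^-1 = fp_inj g2^-1 :> FP.
  by apply/mulg1_eq; rewrite -fp_injM mulgV fp_inj1.
exact: (group_closedV gH).
Qed.

Definition coset_edge i u (e : cayley_edge (S i)) : edge :=
  (u * fp_inj e.1, lift_gen e.2).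

Lemma coset_edge_inj i u : injective (@coset_edge i u).
Proof.
move=> [g s] [h s'] e; congr (_, _).
  have : u * fp_inj g = u * fp_inj h := congr1 fst e.
  by move/mulgI/fp_inj_inj.
have : fp_inj (val s) = fp_inj (val s') := congr1 (fun e : edge => val e.2) e.
by move/fp_inj_inj/val_inj.
Qed.

Definition coset_cluster i w u : set (G i) :=
  cluster (relabel (@coset_edge i u) w).

Fixpoint chain w u r : Prop :=
  if r is x :: r' then
    @coset_cluster (tag x) w u (tagged x) /\ chain w (u * letter_inj x) r'
  else True.

Lemma chain_rcons w u r x : chain w u (rcons r x) <->
  chain w u r /\ @coset_cluster (tag x) w (u * word_prod r) (tagged x).
Proof.
elim: r u => [|y r IHr] u /=; first by rewrite mulg1; split=> -[].
by rewrite IHr mulgA; split=> [[? []]|[[? ?]]].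
Qed.

Lemma chain_mul_inj w a i (g : G i) : ~~ ends i (fp_word a) ->
  chain w 1 (fp_word (a * fp_inj g)) <->
  chain w 1 (fp_word a) /\ coset_cluster w a g.
Proof.
move=> ai; have [->|g1] := eqVneq g 1.
  by rewrite fp_inj1 mulg1; split=> [?|[]//]; split=> //; exact: cluster1.
by rewrite fp_word_mul_inj// chain_rcons mul1g fp_wordK.
Qed.

Lemma coset_cluster_sub w u i (g : G i) : cluster w u -> coset_cluster w u g ->
  cluster w (u * fp_inj g).
Proof.
move=> wu; move: g; apply: cluster_ind; first by rewrite fp_inj1 mulg1.
move=> g s ws; rewrite fp_injM mulgA.
exact: (cluster_edge (s := lift_gen s) ws).
Qed.

(* Every vertex [u] is a cut vertex between the cosets meeting at [u], so the
   cluster is described coset by coset along reduced words. *)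
Lemma cluster_chain w u : cluster w u <-> chain w 1 (fp_word u).
Proof.
split.
  move: u; apply: cluster_ind => // u s ws.
  have [i [s' es]] := lift_genP s; have [a [g [eu ai]]] := last_letter i u.
  have -> : u * val s = a * fp_inj (g * val s').
    by rewrite eu es fp_injM mulgA.
  have ws' : relabel (@coset_edge i a) w (g, s').
    by rewrite /relabel /coset_edge /= -eu -es.
  rewrite {1}eu !chain_mul_inj// /coset_cluster (cluster_edge ws').
  by split.
rewrite -{2}[u]mul1g -{2}[u]fp_wordK.
elim: (fp_word u) (1 : FP) (cluster1 w) => [|x r IHr] v wv /=.
  by rewrite mulg1.
by move=> [xc /IHr]; rewrite mulgA; apply; exact: coset_cluster_sub.
Qed.

(* The base point of the coset containing an edge. A loop at the identity
   generator lies in several cosets and gets the junk value [::]. *)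
Definition owner (e : edge) : seq letter :=
  if fp_word (val e.2) is y :: _ then strip (tag y) (fp_word e.1) else [::].

Lemma owner_coset_edge i a (e : cayley_edge (S i)) : ~~ ends i (fp_word a) ->
  val e.2 != 1 -> owner (coset_edge a e) = fp_word a.
Proof.
by move=> ai e1; rewrite /owner /= /fp_cons (negPf e1) /= strip_mul_inj.
Qed.

(** Loops at an identity generator, whose owner is a junk value, do not move the vertex; every other
    edge of the coset has [fp_word a] as its owner. *)
Lemma coset_cluster_local w w' a i (g : G i) : ~~ ends i (fp_word a) ->
  (forall e, owner e = fp_word a -> w e = w' e) ->
  coset_cluster w a g -> coset_cluster w' a g.
Proof.
move=> ai ww'; move: g; apply: cluster_ind; first exact: cluster1.
move=> g s; have [s1|s1] := eqVneq (val s) 1; first by rewrite s1 mulg1.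
by rewrite /relabel ww' ?owner_coset_edge//; exact: cluster_edge.
Qed.

Lemma chain_local w w' u r : reduced (fp_word u ++ r) ->
  (forall e, prefix (fp_word u) (owner e) -> w e = w' e) ->
  chain w u r -> chain w' u r.
Proof.
elim: r u => //= x r IHr u rur ww' [xc rc].
have := rur; rewrite -cat_rcons => /reduced_catl; rewrite reduced_rcons.
move=> /and3P[_ x1 ux].
have wux : fp_word (u * letter_inj x) = rcons (fp_word u) x.
  by rewrite fp_word_mul_inj//; case: (x).
split.
  by apply: coset_cluster_local xc => // e oe; apply: ww'; rewrite oe prefix_refl.
apply: IHr rc; first by rewrite wux cat_rcons.
move=> e; rewrite wux => pe; apply: ww'; apply: prefix_trans pe.
exact: prefix_rcons.
Qed.

Local Close Scope group_scope.
Variables (R : realType) (p : R).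
Hypotheses (genS : forall i, generates (S i)) (p01 : 0 <= p <= 1).
Local Notation P := (percolation T p).
Local Notation genT := (generates_free_product genS).

Definition letter_conn x : R := conn (S (tag x)) p (tagged x).

Lemma letter_conn_ge0 x : 0 <= letter_conn x. Proof. exact: Pr_ge0. Qed.

Lemma measurable_coset_cluster u i (g : G i) :
  measurable [set w | coset_cluster w u g].
Proof.
rewrite -[X in measurable X]setTI.
exact: (measurable_relabel (@coset_edge i u) measurableT (measurable_cluster g)).
Qed.

Lemma Pr_coset_cluster u i (g : G i) :
  Pr P [set w | coset_cluster w u g] = conn (S i) p g.
Proof.
rewrite /conn /Pr; congr fine.
exact: (bernoulli_relabel (@coset_edge_inj i u) (percolationP genT p01)
  (percolationP (@genS i) p01) (measurable_cluster g)).
Qed.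

Lemma measurable_chain u r : measurable [set w | chain w u r].
Proof.
elim: r u => [|x r IHr] u /=; first exact: measurableT.
apply: (measurableI [set w | coset_cluster w u (tagged x)]
  [set w | chain w (u * letter_inj x)%g r]) => //.
exact: measurable_coset_cluster.
Qed.

Lemma reduced_cons_chain u x r : reduced (fp_word u ++ x :: r) ->
  ~~ ends (tag x) (fp_word u) /\
  fp_word (u * letter_inj x)%g = rcons (fp_word u) x.
Proof.
rewrite -cat_rcons => /reduced_catl; rewrite reduced_rcons => /and3P[_ x1 ux].
by split=> //; rewrite fp_word_mul_inj//; case: (x).
Qed.

(** The first connection depends on edges owned by [u] itself, and [A] on edges whose owners extend
    [u] by [x]. These edge sets are disjoint. *)
Lemma Pr_chain_cons u x r A : reduced (fp_word u ++ x :: r) -> measurable A ->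
  (forall w w',
    (forall e, prefix (rcons (fp_word u) x) (owner e) -> w e = w' e) ->
    A w -> A w') ->
  Pr P ([set w | coset_cluster w u (tagged x)] `&` A) = letter_conn x * Pr P A.
Proof.
move=> rux mA locA; have [ux wux] := reduced_cons_chain rux.
apply: EFin_inj; rewrite EFinM /letter_conn -(Pr_coset_cluster u) -!PrE//;
  last 2 first.
- exact: measurable_coset_cluster.
- by apply: measurableI => //; exact: measurable_coset_cluster.
apply: (bernoulli_independent (percolationP genT p01)
  (D := fun e => owner e = fp_word u)) => //.
- exact: measurable_coset_cluster.
- by move=> w w'; exact: coset_cluster_local.
- move=> w w' ww'; apply: locA => e pe; apply: ww' => oe.
  by move: (size_prefix pe); rewrite oe size_rcons ltnn.
Qed.

Lemma Pr_chain u r : reduced (fp_word u ++ r) ->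
  Pr P [set w | chain w u r] = weight letter_conn r.
Proof.
elim: r u => [|x r IHr] u rur.
  by rewrite /weight big_nil /Pr probability_setT.
have [ux wux] := reduced_cons_chain rur.
rewrite (Pr_chain_cons rur (measurable_chain _ r)); last first.
  by rewrite -wux => w w'; apply: chain_local; rewrite wux cat_rcons.
by rewrite IHr ?wux ?cat_rcons// /weight big_cons.
Qed.

Lemma conn_weight u : conn T p u = weight letter_conn (fp_word u).
Proof.
rewrite -(@Pr_chain 1%g); last exact: fp_wordP.
by congr (Pr _ _); apply/seteqP; split=> w /=; rewrite cluster_chain.
Qed.

Lemma prefix_rcons_eq (s s' : seq letter) x y :
  prefix (rcons s x) s' -> prefix (rcons s y) s' -> x = y.
Proof.
elim: s s' => [|z s IHs] [|z' s'] //=; last first.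
  by case/andP=> _ + /andP[_]; exact: IHs.
by rewrite !prefix0s !andbT => /eqP -> /eqP ->.
Qed.

(** A common first letter factors out. When the first letters differ they may still share a coset,
    so the first connection of the second chain is dropped, at the cost of a factor [C]; its
    remainder lives in the branch beyond [y], which the first chain never enters. *)
Lemma Pr_chain_pair (C : R) u r r' :
  0 <= C -> {in r', forall x, 1 <= C * letter_conn x} -> size r = size r' ->
  reduced (fp_word u ++ r) -> reduced (fp_word u ++ r') ->
  Pr P ([set w | chain w u r] `&` [set w | chain w u r']) <=
    pair_bound letter_conn C r r'.
Proof.
move=> C0; elim: r r' u => [|x r IHr] [|y r'] u //= Cr' sr rur rur'.
  exact: Pr_le1 (measurableI _ _ (measurable_chain u [::])
    (measurable_chain u [::])).
case: sr => sr; have [ux wux] := reduced_cons_chain rur.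
have [uy wuy] := reduced_cons_chain rur'.
case: eqVneq => [xy|xy].
  subst y.
  have loc (q : seq letter) : reduced (fp_word u ++ x :: q) ->
      forall w w', (forall e, prefix (rcons (fp_word u) x) (owner e) ->
      w e = w' e) ->
      chain w (u * letter_inj x)%g q -> chain w' (u * letter_inj x)%g q.
    by move=> ruq w w'; rewrite -wux; apply: chain_local; rewrite wux cat_rcons.
  rewrite (_ : _ `&` _ = [set w | coset_cluster w u (tagged x)] `&`
    ([set w | chain w (u * letter_inj x)%g r] `&`
     [set w | chain w (u * letter_inj x)%g r'])); last first.
    apply/seteqP; split=> w /=; first by move=> [[? ?] [? ?]].
    by move=> [? [? ?]].
  rewrite (Pr_chain_cons rur); last 2 first.
  - by apply: measurableI; exact: measurable_chain.
  - by move=> w w' ww' [/(loc _ rur _ _ ww') ? /(loc _ rur' _ _ ww') ?].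
  rewrite ler_wpM2l ?letter_conn_ge0// IHr ?wux ?cat_rcons//.
  by move=> y yr'; apply: Cr'; rewrite inE yr' orbT.
apply: le_trans (_ : weight letter_conn (x :: r) * weight letter_conn r' <= _);
    last first.
  have wx := weight_ge0 letter_conn_ge0 (x :: r).
  rewrite mulrCA ler_wpM2l//.
  rewrite [weight _ (y :: r')]/weight big_cons -/(weight _ r') mulrA ler_peMl//.
    exact: weight_ge0 letter_conn_ge0 _.
  by apply: Cr'; rewrite inE eqxx.
rewrite -(Pr_chain rur) -(@Pr_chain (u * letter_inj y)%g); last first.
  by rewrite wuy cat_rcons.
have m1 := measurable_chain u (x :: r).
have m2 := measurable_chain u (y :: r').
have m3 := measurable_chain (u * letter_inj y)%g r'.
rewrite -lee_fin EFinM -!PrE//; last exact: measurableI m1 m2.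
rewrite -(bernoulli_independent (percolationP genT p01)
  (D := fun e => ~ prefix (rcons (fp_word u) y) (owner e))).
- apply: le_measure; rewrite ?inE.
  + exact: measurableI m1 m2.
  + exact: measurableI m1 m3.
  + by move=> w [? []].
- exact: m1.
- exact: m3.
- move=> w w' ww' [xc rc]; split.
    apply: coset_cluster_local xc => // e oe; apply: ww' => pe.
    by move: (size_prefix pe); rewrite oe size_rcons ltnn.
  move: rc; apply: chain_local; first by rewrite wux cat_rcons.
  move=> e; rewrite wux => pe; apply: ww' => pe'.
  by move/eqP: xy; apply; exact: prefix_rcons_eq pe pe'.
- move=> w w' ww'; apply: chain_local; first by rewrite wuy cat_rcons.
  by move=> e; rewrite wuy => pe; apply: ww' => /(_ pe).
Qed.

End FreeProductPercolation.

(** * Strict monotonicity of the connection to a generator *)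

Section StrictMonotonicity.
Variables (R : realType) (G : groupType) (S : {fset G}).
Hypothesis genS : generates S.
Implicit Types (p q : R) (s : S).
Local Notation P p := (percolation S p).

Lemma conn1 p : conn S p 1%g = 1.
Proof.
rewrite /conn /Pr (_ : [set _ | _] = setT) ?probability_setT//.
by apply/seteqP; split=> w //= _; exact: cluster1.
Qed.

Lemma conn_generator p s : 0 <= p <= 1 -> p <= conn S p (val s).
Proof.
move=> p01; rewrite -{1}(Pr_edge genS (1%g, s) p01); apply: le_Pr.
- exact: measurable_coord.
- exact: measurable_cluster.
move=> w /= ws; rewrite -[val s]mul1g; apply/(cluster_edge ws); exact: cluster1.
Qed.

(* If every edge at the origin is closed and then (1, s) is sprinkled, [s] joins
   the cluster of the origin. *)
Lemma conn_generator_lt p q s : 0 <= p -> p < q -> q <= 1 -> val s != 1%g ->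
  conn S p (val s) < conn S q (val s).
Proof.
move=> p0 pq q1 s1; have p1 : p < 1 by exact: lt_le_trans q1.
have p01 : 0 <= p <= 1 by rewrite p0 ltW.
set eps := (q - p) / (1 - p).
have eps0 : 0 < eps by rewrite divr_gt0 ?subr_gt0.
have eps01 : 0 <= eps <= 1.
  by rewrite ltW//= ler_pdivrMr ?subr_gt0// mul1r; lra.
pose D : {fset cayley_edge S} :=
  [fset e in [seq step_edge 1%g t | t <- index_enum (S * bool)%type]]%fset.
pose A : set (configuration (cayley_edge S)) := [set w | cluster w (val s)].
pose N := constant_on D false.
pose O : set (configuration (cayley_edge S)) := [set w | w (1%g, s) = true].
have mA : measurable A by exact: measurable_cluster.
have mN : measurable N by exact: measurable_constant_on.
have mO : measurable O by exact: measurable_coord.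
have AN : A `&` N = set0.
  apply/seteqP; split=> // w [Aw Nw].
  suff : val s = 1%g by apply/eqP.
  have {}Aw : cluster w (val s) := Aw; move: (val s) Aw.
  apply: cluster_step_ind => // x t + x1; rewrite x1.
  by rewrite Nw// !inE; apply/mapP; exists t; rewrite ?mem_index_enum.
have PN : Pr (P p) N = (1 - p) ^+ #|` D|.
  by rewrite /Pr (is_bernoulli_constant_on (percolationP genS p01)).
apply: lt_le_trans (_ : Pr (P p) A + Pr (P p) N * Pr (P eps) O <= _).
  rewrite ltrDl PN mulr_gt0 ?exprn_gt0 ?subr_gt0//.
  by rewrite (Pr_edge genS).
rewrite -lee_fin EFinD EFinM -!PrE//.
rewrite (percolation_sprinkle genS p0 (ltW pq) q1 p1 mA) -/eps.
have AT : (P p \x P eps)%E (A `*` setT) = P p A.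
  rewrite product_measure1E//.
  by rewrite [X in (_ * X)%E]probability_setT mule1.
have NO : (P p \x P eps)%E (N `*` O) = (P p N * P eps O)%E.
  by rewrite product_measure1E.
rewrite -AT -NO -measureU; [|exact: measurableX|exact: measurableX|]; last first.
  apply/seteqP; split=> // -[w1 w2] [[/= Aw _] [/= Nw _]].
  by have : (A `&` N) w1 by []; rewrite AN.
apply: le_measure; rewrite ?inE.
- by apply: measurableU; exact: measurableX.
- exact: measurable_preimage_sprinkle.
move=> [w1 w2] /= [[Aw _]|[Nw Ow]].
  by apply: cluster_sub Aw => x s'; rewrite /sprinkle /= => ->.
have ws : sprinkle (w1, w2) (1%g, s) by rewrite /sprinkle /= Ow orbT.
suff : cluster (sprinkle (w1, w2)) (1 * val s)%g by rewrite mul1g.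
by apply/(cluster_edge ws); exact: cluster1.
Qed.

Lemma nontrivial_generator : (exists g : G, g != 1%g) ->
  exists s, val s != 1%g.
Proof.
move=> [g g1]; apply: contrapT => noS; move/negP: g1; apply.
suff : g \in pred1 1%g by [].
apply: genS.
  split; first exact: eqxx.
  by move=> u v /eqP -> /eqP ->; rewrite divg1; exact: eqxx.
move=> s sS; apply/negPn/negP => s1; apply: noS.
by exists [` sS]%fset.
Qed.

End StrictMonotonicity.

(** * Percolation when the criterion exceeds 1 *)

Section Survival.
Variables (R : realType) (n : nat) (G : 'I_n -> groupType).
Variables (S : forall i, {fset G i}).
Hypothesis genS : forall i, generates (S i).
Local Notation letter := {i : 'I_n & G i}.
Local Notation T := (free_product_gens S).
Local Notation genT := (generates_free_product genS).
Implicit Types (p q : R).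

(** The probabilities of the tail unions converge to that of the limit superior, so with probability
    at least [d] chains of infinitely many lengths occur. A finite cluster contains only words of
    bounded length. *)
Lemma theta_gt0_chains p d (W : nat -> seq (seq letter)) : 0 < d ->
  (forall k r, r \in W k -> reduced r /\ size r = k) ->
  (forall k, d <= Pr (percolation T p) [set w | exists2 r, r \in W k &
     [set w | chain w 1%g r] w]) ->
  (0 < theta T p)%E.
Proof.
move=> d0 redW Wd.
pose A k : set (configuration (cayley_edge T)) :=
  [set w | exists2 r, r \in W k & [set w | chain w 1%g r] w].
have mA k : measurable (A k).
  by apply: measurable_bigcup_seq => r; exact: measurable_chain.
have mlim : measurable (lim_sup_set A).
  by apply: bigcap_measurable => // k _; exact: bigcup_measurable.
have inf_lim : lim_sup_set A `<=` [set w | infinite_set (cluster w)].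
  move=> w Aw finw.
  pose m := (\max_(u <- fset_set (cluster w)) size (fp_word u)).+1.
  have [k /= mk [r rW chr]] := Aw m I; have [rr sr] := redW _ _ rW.
  have : cluster w (word_prod r) by apply/cluster_chain; rewrite word_prodK.
  move=> rw; have : (k < m)%N; last by rewrite ltnNge mk.
  rewrite -sr -(word_prodK rr) ltnS.
  apply: (leq_bigmax_seq (word_prod r) (F := fun u => size (fp_word u))) => //.
  by rewrite in_fset_set// inE.
apply: (@lt_le_trans _ _ (percolation T p (lim_sup_set A))); last first.
  apply: le_measure => //; rewrite inE//.
  exact: (measurable_infinite_cluster R genT).
apply: (@lt_le_trans _ _ d%:E); first by rewrite lte_fin.
have cv := lim_sup_set_cvg (percolation T p) A mA.
apply: (cvge_to_ge (cv _)).
  apply: le_lt_trans (probability_le1 _ _) (ltry _).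
  exact: bigcup_measurable.
apply: nearW => k; apply: le_trans (_ : percolation T p (A k) <= _)%E.
  by rewrite PrE// lee_fin; exact: Wd.
apply: le_measure; rewrite ?inE//; first exact: bigcup_measurable.
by move=> w Aw; exists k => /=.
Qed.

Lemma theta_gt0 p (L : seq letter) : 0 <= p <= 1 -> uniq L ->
  all (fun x : letter => tagged x != 1%g) L ->
  (forall x, x \in L -> 0 < letter_conn S p x) ->
  1 < criterion L (letter_conn S p) -> (0 < theta T p)%E.
Proof.
move=> p01 uL L1 L0 s1; set t := letter_conn S p in L0 s1 *.
have t0 x : 0 <= t x by exact: letter_conn_ge0.
(* The sum of the inverses dominates each of them, which gives [1 <= C * t x] on [L], as
   [Pr_chain_pair] requires. *)
pose C := \sum_(x <- L) (t x)^-1.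
have C0 : 0 <= C by apply: sumr_ge0 => x _; rewrite invr_ge0.
have Ct x : x \in L -> 1 <= C * t x.
  move=> xL; rewrite -(mulVf (lt0r_neq0 (L0 _ xL))) ler_wpM2r//.
  by rewrite /C (perm_big _ (perm_to_rem xL)) big_cons lerDl sumr_ge0// => y _;
    rewrite invr_ge0.
pose K := second_moment_bound L t C / (1 + mass L t None)^-1.
have K0 : 0 < K.
  apply: divr_gt0; last by rewrite invr_gt0 ltr_pwDl ?mass_ge0.
  rewrite /second_moment_bound ltr_pwDl//; apply: divr_ge0.
    by apply: mulr_ge0 => //; move: s1; lra.
  by rewrite subr_ge0 ltW.
apply: (theta_gt0_chains (d := K^-1) (W := fun k => words L k None)).
- by rewrite invr_gt0.
- by move=> k r /(words_reduced L1)[].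
move=> k; have redW r : r \in words L k None -> reduced r.
  by move=> /(words_reduced L1)[].
apply: (second_moment_method (c := bias L t None)) => //.
- by move=> r; exact: measurable_chain.
- rewrite -[RHS](sum_bias_weight t0 s1 k None); apply: eq_big_seq => r rW.
  by rewrite (Pr_chain genS p01 (u := 1%g)) ?redW.
apply: le_trans (second_moment_le t0 uL s1 C0 k None).
rewrite big_seq [leRHS]big_seq; apply: ler_sum => r rW.
rewrite big_seq [leRHS]big_seq; apply: ler_sum => r' rW'.
rewrite ler_wpM2l ?mulr_ge0 ?bias_ge0//.
have [rr _ sr _] := words_reduced L1 rW.
have [rr' _ sr' rL'] := words_reduced L1 rW'.
apply: (Pr_chain_pair genS p01) => //; last by rewrite sr sr'.
by move=> x /rL'; exact: Ct.
Qed.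

End Survival.

(** * Finiteness of the mean below a non-percolating parameter *)

Section CriticalPoint.
Variables (R : realType) (n : nat) (G : 'I_n -> groupType).
Variables (S : forall i, {fset G i}).
Hypothesis n_ge2 : (2 <= n)%N.
Hypothesis G_nontrivial : forall i, exists g : G i, g != 1%g.
Hypothesis genS : forall i, generates (S i).
Local Notation letter := {i : 'I_n & G i}.
Local Notation T := (free_product_gens S).
Local Notation genT := (generates_free_product genS).
Implicit Types (p q : R).

Definition gen_letter i (s : S i) : letter := Tagged G (val s).

Lemma two_generators : exists (i j : 'I_n) (s : S i) (s' : S j),
  [/\ i != j, val s != 1%g & val s' != 1%g].
Proof.
pose i0 : 'I_n := Ordinal (ltnW n_ge2); pose i1 : 'I_n := Ordinal n_ge2.
have [s s1] := nontrivial_generator (@genS i0) (G_nontrivial i0).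
have [s' s'1] := nontrivial_generator (@genS i1) (G_nontrivial i1).
by exists i0, i1, s, s'.
Qed.

(** All edges are almost surely open, so the words alternating between generators of two factors are
    chains of every length. This makes the set defining the critical probability non-empty. *)
Lemma theta1_gt0 : (0 < theta T (1 : R))%E.
Proof.
have [i [j [s [s' [ij s1 s'1]]]]] := two_generators.
pose x b : letter := if b then gen_letter s else gen_letter s'.
have x1 b : tagged (x b) != 1%g by case: b.
have xx b : tag (x b) != tag (x (~~ b)) by case: b => //=; rewrite eq_sym.
pose fix alternate b k := if k is k'.+1 then x b :: alternate (~~ b) k' else [::].
have alternateP b k : reduced (alternate b k) /\ size (alternate b k) = k.
  elim: k b => //= k IHk b; have [rk sk] := IHk (~~ b); split; last by rewrite sk.
  by apply: reduced_cons_letter => //; case: k {IHk sk} rk => //= *.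
have p01 : 0 <= (1 : R) <= 1 by rewrite ler01 lexx.
apply: (theta_gt0_chains genS (d := 1)
  (W := fun k => [:: alternate true k])) => //.
  by move=> k r; rewrite inE => /eqP ->.
move=> k; rewrite (_ : [set w | _] = [set w | chain w 1%g (alternate true k)]).
  rewrite (Pr_chain genS p01 (u := 1%g)); last by have [] := alternateP true k.
  move: true; elim: k => [|k IHk] b; rewrite /weight /= ?big_nil// big_cons.
  rewrite -[leLHS]mulr1 ler_pM//; last exact: IHk.
  by case: b; exact: conn_generator.
apply/seteqP; split=> w /=; first by move=> [r]; rewrite inE => /eqP ->.
by move=> ch; exists (alternate true k); rewrite ?inE.
Qed.

Lemma criterion_le1 p (L : seq letter) : 0 <= p <= 1 -> uniq L ->
  all (fun x : letter => tagged x != 1%g) L -> theta T p = 0%E ->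
  criterion L (letter_conn S p) <= 1.
Proof.
move=> p01 uL L1 th0; rewrite leNgt; apply/negP => s1.
(* Letters of probability zero do not change the masses; discarding them provides the positivity
   asked for by [theta_gt0]. *)
pose L' := [seq x <- L | 0 < letter_conn S p x].
have massE i : mass L' (letter_conn S p) i = mass L (letter_conn S p) i.
  rewrite /mass big_filter_cond [RHS]big_mkcond [LHS]big_mkcond.
  apply: eq_bigr => x _.
  case: ltP => //= h; case: ifP => // _; apply/eqP.
  by rewrite eq_le h letter_conn_ge0.
have : (0 < theta T p)%E; last by rewrite th0 ltxx.
apply: (@theta_gt0 _ _ _ _ genS _ L') => //.
- by rewrite filter_uniq.
- by apply/allP => x; rewrite mem_filter => /andP[_ /(allP L1)].
- by move=> x; rewrite mem_filter => /andP[].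
- by rewrite /criterion; under eq_bigr do rewrite massE.
Qed.

Let ratio_mono (a b : R) : 0 <= b -> b <= a -> b / (1 + b) <= a / (1 + a).
Proof.
move=> b0 ba; have a0 := le_trans b0 ba.
by rewrite ler_pdivrMr ?ltr_pwDl// mulrAC ler_pdivlMr ?ltr_pwDl//; nra.
Qed.

(* If two terms [a / (1 + a)] and [a' / (1 + a')] have sum at most 1, a lower
   bound on [a'] bounds [a] from above, and lowering [a] by [d] then lowers
   [a / (1 + a)] by a definite amount. *)
Let ratio_gap (a b a' c d : R) : 0 < c -> 0 < d -> 0 <= b -> b + d <= a ->
  c <= a' -> a / (1 + a) + a' / (1 + a') <= 1 ->
  b / (1 + b) + d * (c / (1 + c)) ^+ 2 <= a / (1 + a).
Proof.
move=> c0 d0 b0 bda ca' s1.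
have ac : a / (1 + a) + c / (1 + c) <= 1.
  by apply: le_trans s1; rewrite lerD2l ratio_mono// ltW.
have c1 : 0 < 1 + c by lra.
have a1 : 0 < 1 + a by lra.
have b1 : 0 < 1 + b by lra.
set e := c / (1 + c) in ac *.
have e0 : 0 < e by rewrite divr_gt0.
have ea : e <= (1 + a)^-1.
  have : a / (1 + a) = 1 - (1 + a)^-1 by field; lra.
  lra.
have eb : e <= (1 + b)^-1.
  by apply: le_trans ea _; rewrite lef_pV2 ?posrE//; lra.
have -> : a / (1 + a) = b / (1 + b) + (a - b) * ((1 + a)^-1 * (1 + b)^-1).
  by field; rewrite !lt0r_neq0.
rewrite lerD2l; apply: ler_pM; [exact: ltW|exact: sqr_ge0|lra|].
by rewrite expr2; apply: ler_pM => //; exact: ltW.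
Qed.

(** Absence of percolation keeps the criterion at [q] at most 1 for each finite alphabet. The strict
    increase at one generator lowers it at [p] by a fixed [gap], so all finite partial sums of the
    mean are at most [gap^-1]. *)
Lemma finite_mean p q : 0 <= p -> p < q -> q <= 1 -> theta T q = 0%E ->
  (mean_cluster_size T p < +oo)%E.
Proof.
move=> p0 pq q1 thq.
have q01 : 0 <= q <= 1 by rewrite q1 andbT ltW// (le_lt_trans p0).
have p01 : 0 <= p <= 1 by rewrite p0 ltW// (lt_le_trans pq).
have [i [j [s [s' [ij s1 s'1]]]]] := two_generators.
set tp := letter_conn S p; set tq := letter_conn S q.
have tp0 x : 0 <= tp x by exact: letter_conn_ge0.
have tq0 x : 0 <= tq x by exact: letter_conn_ge0.
have tpq x : tp x <= tq x by apply: conn_mono => //; exact: ltW.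
pose d := tq (gen_letter s) - tp (gen_letter s).
have d0 : 0 < d by rewrite subr_gt0; exact: conn_generator_lt.
pose c := tq (gen_letter s').
have c0 : 0 < c.
  by apply: lt_le_trans (conn_generator (@genS j) s' q01); exact: le_lt_trans pq.
pose gap := d * (c / (1 + c)) ^+ 2.
have gap0 : 0 < gap by rewrite mulr_gt0// exprn_gt0// divr_gt0// ltr_pwDl// ltW.
rewrite (mean_cluster_sizeE genT); apply: le_lt_trans (ltry gap^-1).
apply: esum_le_fsets => Z.
(* Both generators are put into every alphabet, so that [gap], fixed before [Z], applies
   uniformly. *)
pose L := undup (gen_letter s :: gen_letter s' ::
  flatten [seq fp_word u | u <- enum_fset Z]).
have uL : uniq L by exact: undup_uniq.
have L1 : all (fun x : letter => tagged x != 1%g) L.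
  apply/allP => x; rewrite mem_undup !inE.
  case/or3P=> [/eqP->//|/eqP->//|/flattenP[r /mapP[u _ ->]]].
  by have /andP[/allP + _] := fp_wordP u; apply.
have sL : gen_letter s \in L by rewrite mem_undup inE eqxx.
have s'L : gen_letter s' \in L by rewrite mem_undup !inE eqxx orbT.
have ZL u : u \in Z -> {subset fp_word u <= L}.
  move=> uZ x xu; rewrite mem_undup !inE; apply/orP; right; apply/orP; right.
  by apply/flattenP; exists (fp_word u) => //; exact: map_f.
have crit : criterion L tp <= 1 - gap.
  have critq : criterion L tq <= 1 by exact: criterion_le1.
  have mle k : mass L tp k <= mass L tq k by exact: ler_sum.
  have mi : mass L tp (Some i) + d <= mass L tq (Some i).
    rewrite /mass big_mkcond [leRHS]big_mkcond.
    rewrite (bigD1_seq (gen_letter s))//= [leRHS](bigD1_seq (gen_letter s))//=.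
    rewrite !eqxx addrAC; apply: lerD; first by rewrite /d addrC subrK.
    by apply: ler_sum => x _; case: ifP.
  have mj : c <= mass L tq (Some j).
    rewrite /mass big_mkcond (bigD1_seq (gen_letter s'))//= eqxx lerDl.
    by apply: sumr_ge0 => x _; case: ifP.
  have term_ge0 k : 0 <= mass L tq (Some k) / (1 + mass L tq (Some k)).
    by rewrite divr_ge0 ?addr_ge0 ?mass_ge0.
  have ijle : mass L tq (Some i) / (1 + mass L tq (Some i)) +
      mass L tq (Some j) / (1 + mass L tq (Some j)) <= 1.
    apply: le_trans critq; rewrite /criterion (bigD1 i)//= lerD2l.
    by rewrite (bigD1 j)/= 1?eq_sym// lerDl sumr_ge0.
  have := ratio_gap c0 d0 (mass_ge0 L tp0 (Some i)) mi mj ijle.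
  rewrite -/gap => gapi; rewrite lerBrDr; apply: le_trans critq.
  rewrite /criterion (bigD1 i)//= [leRHS](bigD1 i)//= addrAC lerD//.
  by apply: ler_sum => k _; apply: ratio_mono => //; exact: mass_ge0.
have crit1 : criterion L tp < 1 by lra.
under eq_bigr do rewrite (conn_weight genS p01).
apply: le_trans (sum_weight_fset_le tp0 crit1 ZL) _.
by rewrite lef_pV2 ?posrE ?subr_gt0//; lra.
Qed.

End CriticalPoint.

(** * The mean cluster size below the critical point *)

(** For positive [c] one inequality suffices: the other is the same one with factor [c^-1]. *)
Lemma esumZl (R : realType) (T : choiceType) (D : set T) (c : R) (a : T -> R) :
  0 <= c -> (forall x, 0 <= a x) ->
  (\esum_(x in D) (c * a x)%:E = c%:E * \esum_(x in D) (a x)%:E)%E.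
Proof.
move=> + a0.
have le (k : R) (b : T -> R) : 0 <= k ->
    (\esum_(x in D) (k * b x)%:E <= k%:E * \esum_(x in D) (b x)%:E)%E.
  move=> k0; apply: ge_ereal_sup => _ [X [finX XD] <-].
  rewrite fsbig_finite//= sumEFin -mulr_sumr EFinM lee_wpmul2l ?lee_fin//.
  by apply: esum_ge; exists X => //; rewrite fsbig_finite//= sumEFin.
rewrite le_eqVlt => /predU1P[<-|c0].
  by rewrite mul0e esum1// => x _; rewrite mul0r.
apply/eqP; rewrite eq_le (le _ _ (ltW c0))/=.
have := le c^-1 (fun x => c * a x); rewrite invr_ge0 ltW// => /(_ isT).
rewrite (eq_esum (b := fun x => (a x)%:E)); last first.
  by move=> x _; rewrite mulrA mulVf ?mul1r// gt_eqF.
move=> h; rewrite -[leRHS]mul1e -[1%E]/(1%R%:E) -(mulfV (lt0r_neq0 c0)) EFinM.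
by rewrite -muleA lee_wpmul2l// lee_fin ltW.
Qed.

Section MeanFormula.
Variables (R : realType) (n : nat) (G : 'I_n -> groupType).
Variables (S : forall i, {fset G i}).
Hypothesis genS : forall i, generates (S i).
Local Notation letter := {i : 'I_n & G i}.
Local Notation FP := (free_product G).
Local Notation T := (free_product_gens S).
Local Notation genT := (generates_free_product genS).
Variable p : R.
Hypothesis p01 : 0 <= p <= 1.
Implicit Types (u : FP) (i : 'I_n).

Definition avoiding i : set FP := [set u | avoids (Some i) (fp_word u)].

Lemma fp_word_mul_avoiding i (g : G i) u : avoiding i u ->
  fp_word (fp_inj g * u)%g = fp_cons g (fp_word u).
Proof.
rewrite fp_word_injM /avoiding /=; case: (fp_word u) => [|x w] /=.
  by rewrite /fp_push /= mulg1.
by move=> xi; rewrite /fp_push /= (negPf (xi : tag x != i)) mulg1.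
Qed.

Lemma conn_mul_avoiding i (g : G i) u : avoiding i u ->
  conn T p (fp_inj g * u)%g = conn (S i) p g * conn T p u.
Proof.
move=> ui; rewrite !(conn_weight genS p01) fp_word_mul_avoiding// /fp_cons.
case: eqVneq => [->|g1]; first by rewrite conn1 mul1r.
by rewrite /weight big_cons.
Qed.

(** The inverse is given by [fp_head] and [fp_tail], which split off the leading letter of type [i],
    or 1 if there is none. *)
Lemma avoiding_bij i :
  set_bij ([set: G i] `*`` (fun=> avoiding i)) [set: FP]
    (fun gu => (fp_inj gu.1 * gu.2)%g).
Proof.
split=> //.
  move=> [g u] [h v]; rewrite !inE => -[/= _ ui] [/= _ vi] e.
  have {e} := congr1 (@fp_word _ _) e.
  rewrite !fp_word_mul_avoiding// => e; congr (_, _).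
    by have := congr1 (@fp_head _ G i) e; rewrite !fp_head_cons.
  by apply/val_inj; have := congr1 (@fp_tail _ G i) e; rewrite !fp_tail_cons.
move=> u _.
have ti : avoiding i (FreeProduct (reduced_tail i (fp_wordP u))).
  exact: fp_no_head_tail (fp_wordP u).
exists (fp_head i u, FreeProduct (reduced_tail i (fp_wordP u))) => //.
apply/val_inj; apply: etrans (fp_word_mul_avoiding _ ti) _.
exact: fp_consK (fp_wordP u).
Qed.

Let E (D : set FP) := (\esum_(u in D) (conn T p u)%:E)%E.

(** Reindexing by [avoiding_bij] gives a double sum, which factorises by [conn_mul_avoiding].
    Finiteness of the mean makes the second factor a real number that can be pulled out. *)
Lemma mean_avoiding i : (mean_cluster_size T p < +oo)%E ->
  (mean_cluster_size T p = mean_cluster_size (S i) p * E (avoiding i))%E.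
Proof.
rewrite (mean_cluster_sizeE genT) (mean_cluster_sizeE (@genS i)) => Efin.
have Ei0 : (0 <= E (avoiding i))%E.
  by apply: esum_ge0 => u _; rewrite lee_fin conn_ge0.
have Eifin : E (avoiding i) \is a fin_num.
  rewrite ge0_fin_numE//; apply: le_lt_trans Efin.
  rewrite /E esum_mkcond; apply: le_esum => u _.
  by case: ifP => _; rewrite lee_fin ?conn_ge0.
rewrite (reindex_esum _ _ _ _ (avoiding_bij i)).
rewrite -(esum_esum (a := fun g u => (conn T p (fp_inj g * u)%g)%:E)); last first.
  by move=> g u _ _; rewrite lee_fin conn_ge0.
rewrite -(fineK Eifin) muleC -esumZl; [|exact: fine_ge0|exact: conn_ge0].
apply: eq_esum => g _; rewrite [(_ * conn _ _ g)%R]mulrC EFinM (fineK Eifin).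
rewrite /E -esumZl; [|exact: conn_ge0..].
by apply: eq_esum => u ui; rewrite conn_mul_avoiding.
Qed.

(** The identity contributes 1, and every other word lies in the complement of exactly one
    [avoiding i], determined by its first letter. *)
Lemma mean_first_letter :
  mean_cluster_size T p = (1 + \sum_(i < n) E (~` avoiding i))%E.
Proof.
have c0 u : (0 <= (conn T p u)%:E)%E by rewrite lee_fin conn_ge0.
rewrite (mean_cluster_sizeE genT).
rewrite (esumID [set 1%g])//; congr (_ + _)%E.
  by rewrite setTI esum_set1// conn1.
rewrite setTI esum_mkcond /E.
under [RHS]eq_bigr do rewrite esum_mkcond.
rewrite -esum_sum; last by move=> u i _ _; case: ifP.
apply: eq_esum => u _; case: ifPn; rewrite ?notin_setE ?inE /=.
  case wE: (fp_word u) => [|x w] u1; first by case: u1; apply/val_inj.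
  rewrite (bigD1 (tag x))//= big1 ?adde0.
    by rewrite ifT// inE /avoiding /= wE /= eqxx.
  move=> i ix; rewrite ifF//; apply/negP; rewrite inE; apply.
  by rewrite /avoiding /= wE /=; apply: contra ix => /eqP[->].
move=> /contrapT ->; rewrite big1// => i _; rewrite ifF//.
by apply/negP; rewrite inE; apply.
Qed.

(* With [x] the mean over the free product, [chi i] the factor means and [t i]
   the sums over words not starting in factor [i], [mean_avoiding] reads
   [x = chi i * t i] and [mean_first_letter] reads [x = 1 + \sum_i (x - t i)];
   eliminate [t]. *)
Lemma mean_formula : (mean_cluster_size T p < +oo)%E ->
  exists (x : R) (chi : 'I_n -> R), [/\ 0 < x, forall i, 0 < chi i,
    mean_cluster_size T p = x%:E,
    forall i, mean_cluster_size (S i) p = (chi i)%:E &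
    x * (\sum_(i < n) (chi i)^-1 - (n%:R - 1)) = 1].
Proof.
move=> Tfin; have T0 : (0 <= mean_cluster_size T p)%E.
  rewrite (mean_cluster_sizeE genT); apply: esum_ge0 => u _.
  by rewrite lee_fin conn_ge0.
have Tfn : mean_cluster_size T p \is a fin_num by rewrite ge0_fin_numE.
have TE : mean_cluster_size T p = E setT by rewrite (mean_cluster_sizeE genT).
have split_E i : mean_cluster_size T p = (E (avoiding i) + E (~` avoiding i))%E.
  rewrite TE /E (esumID (avoiding i)) ?setTI// => u _.
  by rewrite lee_fin conn_ge0.
have E0 D : (0 <= E D)%E.
  by apply: esum_ge0 => u _; rewrite lee_fin conn_ge0.
have Efin D : E D \is a fin_num.
  rewrite ge0_fin_numE//; apply: le_lt_trans Tfin; rewrite TE.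
  rewrite /E esum_mkcond; apply: le_esum => u _.
  by case: ifP => _; rewrite lee_fin ?conn_ge0.
have one_le (H : groupType) (D : set H) (a : H -> R) :
    (forall x, 0 <= a x) -> D 1%g -> a 1%g = 1 ->
    (1 <= \esum_(x in D) (a x)%:E)%E.
  move=> a0 D1 a1; apply: esum_ge; exists [set 1%g].
    by split; [exact: finite_set1|move=> _ ->].
  by rewrite fsbig_set1 a1.
have t1 i : 1 <= fine (E (avoiding i)).
  rewrite -lee_fin fineK//; apply: one_le => //; last exact: conn1.
  by move=> u; exact: conn_ge0.
have chi1 i : (1 <= mean_cluster_size (S i) p)%E.
  rewrite (mean_cluster_sizeE (@genS i)); apply: one_le => //.
    by move=> u; exact: conn_ge0.
  exact: conn1.
(* An infinite factor mean, multiplied by a sum that is at least 1, would make the mean over the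
   free product infinite. *)
have chifin i : mean_cluster_size (S i) p \is a fin_num.
  have := mean_avoiding i Tfin; have := chi1 i.
  case: (mean_cluster_size (S i) p) => // _ h; exfalso; move: Tfin.
  rewrite h -(fineK (Efin _)) gt0_mulye ?ltxx// lte_fin.
  exact: lt_le_trans ltr01 (t1 i).
pose x := fine (mean_cluster_size T p).
pose chi i := fine (mean_cluster_size (S i) p).
pose t i := fine (E (avoiding i)).
have chi_gt0 i : 0 < chi i.
  by rewrite -lte_fin fineK//; apply: lt_le_trans (chi1 i); rewrite lte_fin.
have xt i : x = chi i * t i.
  by apply: EFin_inj; rewrite EFinM !fineK//; exact: mean_avoiding.
have xsum : x = 1 + \sum_(i < n) (x - t i).
  apply: EFin_inj; rewrite EFinD -sumEFin fineK// [LHS]mean_first_letter.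
  congr (_ + _)%E; apply: eq_bigr => i _; rewrite EFinB !fineK//.
  by rewrite (split_E i) addeAC subee ?add0e.
have x0 : 0 < x.
  rewrite -lte_fin fineK// mean_first_letter; apply: (@lt_le_trans _ _ 1%E).
    by rewrite lte_fin.
  by rewrite leeDl// sume_ge0.
exists x, chi; split=> //.
- by rewrite fineK.
- by move=> i; rewrite fineK.
have tE i : t i = x * (chi i)^-1 by rewrite (xt i) mulrAC mulfV ?mul1r// gt_eqF.
rewrite mulrBr mulr_sumr; under eq_bigr do rewrite -tE.
move: xsum; rewrite sumrB sumr_const card_ord -mulr_natr; lra.
Qed.

End MeanFormula.

(** * The formula below the critical probability, and divergence from it on *)

Theorem corollary3 (R : realType) (n : nat) (n_ge2 : (2 <= n)%N)
    (G : 'I_n -> groupType) (S : forall i : 'I_n, {fset G i})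
    (G_nontrivial : forall i : 'I_n, exists g : G i, g != 1%g)
    (S_generates : forall i : 'I_n, generates (S i)) :
  let pc : R := critical_probability (free_product_gens S) R in
  let chi (i : 'I_n) (p : R) : \bar R := mean_cluster_size (S i) p in
  let denominator (p : R) : \bar R :=
    ((\sum_(j < n) \prod_(i < n | i != j) chi i p)
      - (n%:R - 1)%:E * \prod_(i < n) chi i p)%E in
  (forall p : R, 0 <= p < pc ->
    [/\ forall i : 'I_n, chi i p \is a fin_num,
        denominator p != 0%E &
        mean_cluster_size (free_product_gens S) p =
          (\prod_(i < n) chi i p / denominator p)%E]) /\
  (forall p : R, pc <= p <= 1 ->
    mean_cluster_size (free_product_gens S) p = +oo%E).
Proof.
move=> pc chi den; have genT := generates_free_product S_generates.
(* The infimum of [A] is [pc]. As [A] contains 1 and is bounded below by 0, [inf] is a genuine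
   infimum and not a default value. *)
pose A := [set p : R | (0 <= p <= 1)%R /\ (0 < theta (free_product_gens S) p)%E].
have A1 : A 1.
  by split; [rewrite ler01 lexx|exact: theta1_gt0].
have lbA : lbound A 0 by move=> p [/andP[]].
have hlbA : has_lbound A by exists 0.
have theta0 q : 0 <= q <= 1 -> q < pc -> theta (free_product_gens S) q = 0%E.
  move=> q01 qpc; apply/eqP; rewrite eq_le measure_ge0 andbT leNgt.
  apply/negP => thq; move: qpc; rewrite ltNge => /negP; apply.
  by apply: ge_inf.
have pc1 : pc <= 1 by exact: ge_inf.
have pc0 : 0 <= pc by apply: lb_le_inf => //; exists 1.
split=> [p /andP[p0 ppc]|p /andP[pcp p1]].
  have p01 : 0 <= p <= 1 by rewrite p0 ltW// (lt_le_trans ppc).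
  pose q := (p + pc) / 2.
  have [pq qpc] : p < q /\ q < pc by rewrite /q; split; lra.
  have q1 : q <= 1 by lra.
  have fin : (mean_cluster_size (free_product_gens S) p < +oo)%E.
    apply: (finite_mean n_ge2 G_nontrivial S_generates p0 pq q1).
    by apply: theta0 => //; rewrite q1 andbT; lra.
  have [x [c [x0 c0 TE chiE xE]]] := mean_formula S_generates p01 fin.
  (* Factoring out the product of the [c i] leaves the sum of their inverses minus [n - 1], which is
     [x^-1] by [xE]. *)
  have denE : den p = (\prod_(i < n) c i / x)%:E.
    rewrite /den /chi.
    have prodE (Q : pred 'I_n) : (\prod_(i < n | Q i) mean_cluster_size (S i) p =
        (\prod_(i < n | Q i) c i)%:E)%E.
      by rewrite -prodEFin; apply: eq_bigr => i _; rewrite chiE.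
    under eq_bigr do rewrite prodE.
    rewrite prodE sumEFin -EFinM -EFinB; congr EFin.
    have -> : x^-1 = \sum_(i < n) (c i)^-1 - (n%:R - 1).
      by apply: (mulfI (lt0r_neq0 x0)); rewrite xE mulfV// gt_eqF.
    rewrite mulrBr mulr_sumr [X in _ = _ - X]mulrC; congr (_ - _).
      apply: eq_bigr => j _; rewrite [in RHS](bigD1 j)//=.
      by rewrite mulrAC mulfV ?mul1r// gt_eqF.
  have prod0 : \prod_(i < n) c i != 0.
    by rewrite gt_eqF// prodr_gt0.
  have d0 : \prod_(i < n) c i / x != 0.
    by rewrite mulf_neq0// invr_eq0 gt_eqF.
  split.
  - by move=> i; rewrite /chi chiE.
  - by rewrite denE eqe.
  rewrite denE TE inver (negPf d0) /chi; under eq_bigr do rewrite chiE.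
  rewrite prodEFin -EFinM; congr EFin; field.
  by rewrite prod0 gt_eqF.
(* A finite mean at [p] excludes [p = 1], where percolation occurs, and yields some [q > p] with
   [theta] zero. By monotonicity [q] is a lower bound of [A], so [q <= pc], against [pc <= p]. *)
apply/eqP; rewrite -leye_eq leNgt; apply/negP => fin.
have p1' : p < 1.
  rewrite lt_neqAle p1 andbT; apply/eqP => pE; move: fin; rewrite pE => fin.
  by case: A1 => _; rewrite (theta_eq0 genT fin) ltxx.
have [q [pq q1 thq]] := finite_mean_open genT (le_trans pc0 pcp) p1' fin.
have : q <= pc.
  apply: lb_le_inf; first by exists 1.
  move=> r [/andP[r0 r1] thr]; rewrite leNgt; apply/negP => rq.
  have := theta_mono genT r0 (ltW rq) q1.
  by rewrite thq leNgt thr.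
by rewrite leNgt (le_lt_trans pcp pq).
Qed.
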